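(* Let $(Z,d_Z)$ be a separable metric space and $p\in[1,\infty]$. Then $\mathrm{GW}_p^Z$ induces a metric on $\mathcal{M}_\sim^{Z,p}$, the space of $(Z,p)$-networks considered up to weak isomorphism.
   Context: A $(Z,p)$-network is a triple $(X,\omega_X,\mu_X)$ where $X$ is a Polish space, $\mu_X$ is a Borel probability measure on $X$, and $\omega_X:X\times X\to Z$ is measurable with $\|d_Z(\omega_X(\cdot,\cdot),z_0)\|_{L^p(\mu_X\otimes\mu_X)}<\infty$ for some (equivalently every) $z_0\in Z$. $\mathcal{C}(\mu_X,\mu_Y)$ is the set of probability measures on $X\times Y$ with marginals $\mu_X$ and $\mu_Y$. Define $$\mathrm{GW}_p^Z(X,Y)=\tfrac12\inf_{\pi\in\mathcal{C}(\mu_X,\mu_Y)}\big\|(x,y,x',y')\mapsto d_Z(\omega_X(x,x'),\omega_Y(y,y'))\big\|_{L^p(\pi\otimes\pi)}$$ (essential supremum if $p=\infty$). $(Z,p)$-networks $X$ and $Y$ are weakly isomorphic, $X\sim Y$, if there exist a $(Z,p)$-network $(W,\omega_W,\mu_W)$ and measurable maps $\phi_X:W\to X$, $\phi_Y:W\to Y$ with $(\phi_X)_*\mu_W=\mu_X$, $(\phi_Y)_*\mu_W=\mu_Y$ and $\omega_W(w,w')=\omega_X(\phi_X(w),\phi_X(w'))=\omega_Y(\phi_Y(w),\phi_Y(w'))$ for $\mu_W\otimes\mu_W$-almost every $(w,w')$. $\mathcal{M}_\sim^{Z,p}$ is the quotient of the collection of all $(Z,p)$-networks by $\sim$. ''Induces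 a metric'' means: $\mathrm{GW}_p^Z$ is finite, nonnegative, symmetric, satisfies the triangle inequality, and $\mathrm{GW}_p^Z(X,Y)=0$ if and only if $X\sim Y$. *)

(* Defs.v *)
From HB Require Import structures.
From mathcomp Require Import all_boot all_order all_algebra.
From mathcomp Require Import all_classical all_reals all_analysis.

Set Implicit Arguments.
Unset Strict Implicit.
Unset Printing Implicit Defensive.

Import Order.TTheory GRing.Theory Num.Theory.

Local Open Scope classical_set_scope.
Local Open Scope ring_scope.
Local Open Scope ereal_scope.

Definition separable_space (T : topologicalType) : Prop :=
  exists2 D : set T, countable D & dense D.

Definition completely_metrizable (R : realType) (T : topologicalType) : Prop :=
  exists dist : T -> T -> R,
    [/\ (forall x y, dist x y = 0%R <-> x = y),
        (forall x y, dist x y = dist y x),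
        (forall x y z, (dist x z <= dist x y + dist y z)%R),
        (forall (x : T) (A : set T),
           nbhs x A <->
           exists2 e : R, (0 < e)%R & [set y | (dist x y < e)%R] `<=` A) &
        (forall u : nat -> T,
           (forall e : R, (0 < e)%R -> exists N : nat,
              forall m n : nat, (N <= m)%N -> (N <= n)%N ->
                (dist (u m) (u n) < e)%R) ->
           exists l : T, u @ \oo --> l)].

Definition polish (R : realType) (T : topologicalType) : Prop :=
  separable_space T /\ completely_metrizable R T.

(* [T] with its Borel sigma-algebra. *)
Notation borel T := (g_sigma_algebraType (@open T)).

(* [measurable_fun setT f] for the Borel sigma-algebra of [Z]; it is spelled
   out because a [measurableType] is pointed, whereas the metric space [Z] is
   not assumed to be nonempty. *)
Definition borel_measurable d (T : measurableType d) (Z : topologicalType)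
    (f : T -> Z) : Prop :=
  forall B : set Z, <<s @open Z >> B -> measurable (f @^-1` B).

(* That the underlying space is pointed is no restriction: it carries a
   probability measure, hence is nonempty.  Nothing below depends on the
   point. *)
Record network (R : realType) (Z : metricType R) (p : \bar R) := Network {
  net_space : ptopologicalType ;
  net_polish : polish R net_space ;
  net_mu : probability (borel net_space) R ;
  net_omega : borel net_space * borel net_space -> Z ;
  net_omega_measurable : borel_measurable net_omega ;
  net_omega_Lp : exists z0 : Z,
    'N[net_mu \x net_mu]_p[(fun q => (mdist (net_omega q) z0)%:E)] < +oo }.

Arguments net_omega {R Z p} n _.

(* A measure is a function on all subsets, so two measures are compared on
   measurable sets only. *)
Definition pushes_to (R : realType) d1 d2 (T1 : measurableType d1)
    (T2 : measurableType d2) (f : T1 -> T2) (mu : set T1 -> \bar R)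
    (nu : set T2 -> \bar R) : Prop :=
  forall A : set T2, measurable A -> pushforward mu f A = nu A.

Section GromovWasserstein.
Context (R : realType) (Z : metricType R) (p : \bar R).
Implicit Types X Y : network Z p.

(* The sigma-algebra on the product is the product of the Borel
   sigma-algebras, i.e. the Borel sigma-algebra of the (Polish) product. *)
Definition couplings X Y :
    set (probability (borel (net_space X) * borel (net_space Y))%type R) :=
  [set pi | pushes_to fst pi (net_mu X) /\ pushes_to snd pi (net_mu Y)].

Definition distortion X Y
    (pi : probability (borel (net_space X) * borel (net_space Y))%type R) :
    \bar R :=
  'N[pi \x pi]_p[(fun q => (mdist (net_omega X (q.1.1, q.2.1))
                                  (net_omega Y (q.1.2, q.2.2)))%:E)].

Arguments couplings : clear implicits.
Arguments distortion : clear implicits.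

Definition GW X Y : \bar R :=
  (2^-1)%:E * ereal_inf [set distortion X Y pi | pi in couplings X Y].

Definition weakly_isomorphic X Y : Prop :=
  exists (W : network Z p)
    (phiX : borel (net_space W) -> borel (net_space X))
    (phiY : borel (net_space W) -> borel (net_space Y)),
    [/\ measurable_fun setT phiX, measurable_fun setT phiY,
        pushes_to phiX (net_mu W) (net_mu X),
        pushes_to phiY (net_mu W) (net_mu Y) &
        \forall q \ae (net_mu W \x net_mu W),
          net_omega W q = net_omega X (phiX q.1, phiX q.2) /\
          net_omega X (phiX q.1, phiX q.2) = net_omega Y (phiY q.1, phiY q.2)].

End GromovWasserstein.
Arguments couplings {R Z p} X Y _.
Arguments distortion {R Z p} X Y pi.

(* [d] is a metric on the quotient of [T] by [equiv].  That [d] descends to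
   the quotient follows from symmetry, the triangle inequality and the last
   clause. *)
Definition induces_metric (R : realType) (T : Type) (equiv : T -> T -> Prop)
    (d : T -> T -> \bar R) : Prop :=
  [/\ (forall x y, d x y \is a fin_num),
      (forall x y, 0 <= d x y),
      (forall x y, d x y = d y x),
      (forall x y z, d x z <= d x y + d y z) &
      (forall x y, d x y = 0 <-> equiv x y)].

(* Main.v *)
Require Import Defs.
From HB Require Import structures.
From mathcomp Require Import all_boot all_order all_algebra.
From mathcomp Require Import all_classical all_reals all_analysis.
From mathcomp Require Import measurable_realfun ess_sup_inf lra.

(** Nonnegativity, symmetry and finiteness are direct: couplings can be
    swapped, the product coupling exists, and Minkowski's inequality bounds its
    distortion by the moments of the two networks.  The two substantial points
    are the triangle inequality and the fact that networks at distance zero are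
    weakly isomorphic.  Both require a measure on a product of which only the
    values on rectangles are known, and both rest on one extension theorem.

    Extension ([rectangle_extension]).  Let [m] be a nonnegative finitely
    additive function on the measurable rectangles [A `*` B] of [E * T], whose
    two marginals are genuine probabilities, and let [T] be Polish.  Then [m]
    extends to a probability.  Probabilities on [T] are inner regular for
    compact sets ([polish_inner_regular]), and compactness in the single factor
    [T] already forces countable subadditivity on rectangles, so that
    Caratheodory's theorem applies.

    Triangle inequality ([GW_triangle]).  Given a coupling [pi] of [X] and [Y]
    and a coupling [rho] of [Y] and [V], let [f C] be the Radon-Nikodym density
    of [rho (_ `*` C)] with respect to the measure of [Y], that is, the
    conditional probability of [C] given the point of [Y].  The formula
    [A `*` C |-> \int[pi]_(w in A) f C w.2] is finitely additive on rectangles,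
    because the densities of finitely many disjoint sets add up almost
    everywhere.  Its extension glues [pi] and [rho] ([gluing]).
    On the glued space the triangle inequality of [Z]
    and Minkowski's inequality conclude.

    Distance zero ([GW0_weakly_isomorphic]).  Take couplings [pi_ n] whose
    distortions tend to zero and an ultrafilter [U] on the integers.  The limit
    along [U] of [pi_ n (A `*` B)] is finitely additive with the same
    marginals, hence extends to a coupling [pi] ([ultralimit_coupling]).  Since
    the couplings all have the same marginals, the convergence passes from rectangles to the
    sets [omega_X in A, omega_Y in B] for the product measures
    ([product_limit]), although [omega_X] and [omega_Y] are only measurable.
    Separability of [Z] covers the set where [omega_X] and [omega_Y] differ by
    countably many such sets, on each of which the two values are at distance
    bounded below; by a Markov-type inequality ([Lnorm_ge_measure]) each has
    measure zero in the limit.  Hence the two network functions agree almost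
    everywhere for [pi], and the product space with [pi] is a common cover of
    [X] and [Y]. *)

Set Implicit Arguments.
Unset Strict Implicit.
Unset Printing Implicit Defensive.

Import Order.TTheory GRing.Theory Num.Theory.
Import numFieldNormedType.Exports.

Local Open Scope classical_set_scope.
Local Open Scope ring_scope.
Local Open Scope ereal_scope.

(** * Metrizable spaces *)

(** The metric is a function separate from the topology, because complete
    metrizability only provides some compatible metric. *)
Definition metrizes (R : realType) (T : topologicalType) (dist : T -> T -> R) :=
  [/\ (forall x y, dist x y = 0%R <-> x = y),
      (forall x y, dist x y = dist y x),
      (forall x y z, (dist x z <= dist x y + dist y z)%R) &
      (forall (x : T) (A : set T), nbhs x A <->
         exists2 e : R, (0 < e)%R & [set y | (dist x y < e)%R] `<=` A)].

Definition countable_base (T : topologicalType) (U : nat -> set T) :=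
  (forall n, open (U n)) /\
  (forall O x, open O -> O x -> exists2 n, U n x & U n `<=` O).

Lemma exists_natSinv_lt (R : realType) (e : R) :
  (0 < e)%R -> exists k : nat, forall n, (k <= n)%N -> (n.+1%:R^-1 < e)%R.
Proof.
by move=> e0; have [k _ kP] := near_infty_natSinv_lt (PosNum e0); exists k.
Qed.

Section metrizable.
Context (R : realType) (T : topologicalType) (dist : T -> T -> R).
Hypothesis distP : metrizes dist.

Lemma metrizes_xx x : dist x x = 0%R.
Proof. by case: distP => H _ _ _; apply/H. Qed.

Lemma metrizes_ge0 x y : (0 <= dist x y)%R.
Proof.
case: distP => _ H2 H3 _; have := H3 x y x.
by rewrite metrizes_xx (H2 y x) -mulr2n pmulrn_lge0.
Qed.

Lemma metrizes_open_lt x r : open [set y | (dist x y < r)%R].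
Proof.
rewrite openE => y /= xy; case: distP => _ _ H3 H4.
apply/H4; exists (r - dist x y)%R; first by rewrite subr_gt0.
move=> z /=; rewrite ltrBrDl; exact: le_lt_trans.
Qed.

Lemma metrizes_open_gt x r : open [set y | (r < dist x y)%R].
Proof.
rewrite openE => y /= xy; case: distP => _ H2 H3 H4.
apply/H4; exists (dist x y - r)%R; first by rewrite subr_gt0.
move=> z /=; rewrite ltrBrDl -ltrBrDr => /lt_le_trans; apply.
by rewrite lerBlDr (H2 y z).
Qed.

Lemma metrizes_closed_le x r : closed [set y | (dist x y <= r)%R].
Proof.
rewrite -[X in closed X]setCK; apply: open_closedC.
rewrite [X in open X](_ : _ = [set y | (r < dist x y)%R]).
  exact: metrizes_open_gt.
by apply/seteqP; split => y /=; rewrite ltNge => /negP.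
Qed.

(** The base consists of the balls of radius 1/(k+1) centred in a countable
    dense set. *)
Lemma metrizes_countable_base :
  separable_space T -> exists U : nat -> set T, countable_base U.
Proof.
case=> D /countable_injP [f finj] Dd; case: distP => H1 H2 H3 H4.
(* f is injective on D, so each union has at most one member; indexing it by
   the code i makes the family total on nat without enumerating D. *)
pose U n := if unpickle n is Some (i, k) then
  \bigcup_(d in [set d | D d /\ f d = i]) [set y | (dist d y < k.+1%:R^-1)%R]
  else set0 : set T.
exists U; split => [n|O x oO Ox].
  rewrite /U; case: unpickle => [[i k]|]; last exact: open0.
  by apply: bigcup_open => d _; exact: metrizes_open_lt.
have : nbhs x O by exact: open_nbhs_nbhs.
move=> /H4[e e0 eO].
have [k /(_ k (leqnn _)) ke] := exists_natSinv_lt (divr_gt0 e0 (ltr0n R 2)).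
have [d [/= xd Dd']] : [set y | (dist x y < k.+1%:R^-1)%R] `&` D !=set0.
  apply: Dd; last exact: metrizes_open_lt.
  by exists x => /=; rewrite metrizes_xx invr_gt0.
exists (pickle (f d, k)); rewrite /U pickleK.
  by exists d => //=; rewrite H2.
move=> y [d' /= [Dd'' fd']].
have -> : d' = d by apply: finj => //; rewrite inE.
move=> dy; apply: eO => /=; apply: (le_lt_trans (H3 _ d _)).
by rewrite (splitr e) ltrD// (lt_trans _ ke).
Qed.

End metrizable.

Lemma open_prod_rectangles (T1 T2 : topologicalType) (U : nat -> set T1)
    (V : nat -> set T2) (O : set (T1 * T2)) :
  countable_base U -> countable_base V -> open O ->
  O = \bigcup_(p in [set p : nat * nat | U p.1 `*` V p.2 `<=` O])
        (U p.1 `*` V p.2).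
Proof.
move=> [oU bU] [oV bV] oO; apply/seteqP; split => [[x y] Oxy|]; last first.
  by move=> z [p pO pz]; exact: pO.
have : nbhs (x, y) O by exact: open_nbhs_nbhs.
case=> -[A B] /= [Ax By] ABO.
have [n Unx UnA] := bU _ _ (@open_interior _ A) Ax.
have [m Vmy VmB] := bV _ _ (@open_interior _ B) By.
exists (n, m) => //= z [/= /UnA/interior_subset Az /VmB/interior_subset Bz].
exact: ABO.
Qed.

Lemma metric_metrizes (R : realType) (Z : metricType R) :
  metrizes (@mdist R Z).
Proof.
split.
- by move=> x y; split => [|->]; [exact: mdist_positivity|exact: mdistxx].
- exact: metric_sym.
- by move=> x y z; exact: metric_triangle.
- move=> x A; rewrite -metricType_numDomainType.filter_from_mdist_nbhs.
  by split => -[e e0 eA]; exists e.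
Qed.

(** * Regularity of probabilities on Polish spaces *)

Lemma borel_open (T : ptopologicalType) (A : set T) :
  open A -> measurable (A : set (borel T)).
Proof. by move=> oA; exact: sub_sigma_algebra. Qed.

Lemma borel_closed (T : ptopologicalType) (A : set T) :
  closed A -> measurable (A : set (borel T)).
Proof.
move=> cA; rewrite -[A]setCK; apply: measurableC; apply: borel_open.
exact: closed_openC.
Qed.

(** Continuity from above, in the form in which it is used below: it provides
    an index rather than a limit. *)
Lemma measure_cap_small d (T : measurableType d) (R : realType)
    (nu : probability T R) (A : nat -> set T) (a e : \bar R) :
  (forall n, measurable (A n)) -> nonincreasing_seq A ->
  nu (\bigcap_n A n) <= a -> a < e -> exists n, nu (A n) < e.
Proof.
move=> mA dA Aa ae.
have /cvg_lim cvgA : nu (A n) @[n --> \oo] --> nu (\bigcap_n A n).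
  apply: nonincreasing_cvg_mu => //.
    by rewrite (le_lt_trans (probability_le1 _ _))// ltry.
  exact: bigcapT_measurable.
apply: contrapT => /forallNP H.
have : e <= nu (\bigcap_n A n).
  rewrite -cvgA//; apply: lime_ge.
    apply: ereal_nonincreasing_is_cvgn => n m nm.
    by apply: le_measure; rewrite ?inE//; apply/subsetPset; exact: dA.
  by apply: nearW => n; rewrite leNgt; apply/negP.
by move=> /le_trans/(_ Aa); rewrite leNgt ae.
Qed.

Section regularity.
Context (R : realType) (T : ptopologicalType) (dist : T -> T -> R).
Hypothesis distP : metrizes dist.
Variable nu : probability (borel T) R.

(** Asking for both approximations at once makes the property visibly stable
    under complements. *)
Definition closed_open_regular (B : set (borel T)) := forall e : R, (0 < e)%R ->
  exists F U : set T, [/\ closed F, open U, F `<=` B, B `<=` U &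
    nu (U `\` F) < e%:E].

(** An open set is the increasing union of the closed sets of points at
    distance at least 1/(n+1) from its complement. *)
Lemma open_regular (B : set (borel T)) :
  open (B : set T) -> closed_open_regular B.
Proof.
move=> oB e e0; case: (distP) => H1 H2 H3 H4.
pose F n := [set x : T | forall y, ~ B y -> (n.+1%:R^-1 <= dist x y)%R].
have cF n : closed (F n).
  rewrite (_ : F n = \bigcap_(y in ~` B) ~` [set x | (dist y x < n.+1%:R^-1)%R]).
    apply: closed_bigI => y _; apply: open_closedC.
    exact: metrizes_open_lt.
  apply/seteqP; split => x Fx y yB /=.
    by rewrite H2; apply/negP; rewrite -leNgt; exact: Fx.
  by rewrite H2 leNgt; apply/negP; exact: Fx.
have FB n : F n `<=` B.
  move=> x Fx; apply: contrapT => /Fx; rewrite metrizes_xx//.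
  by rewrite leNgt invr_gt0 ltr0Sn.
have [n nF] : exists n, nu (B `\` F n) < e%:E.
  apply: (@measure_cap_small _ _ _ _ _ 0); rewrite ?lte_fin//.
  - by move=> n; apply: measurableD; [exact: borel_open|exact: borel_closed].
  - move=> m n mn; apply/subsetPset => x [Bx nFx]; split => // Fx; apply: nFx.
    by move=> y /Fx; apply: le_trans; rewrite lef_pV2 ?posrE// ler_nat.
  rewrite (_ : \bigcap_n _ = set0) ?measure0//.
  apply/seteqP; split => // x /= Ix.
  have Bx : B x by have [] := Ix 0%N I.
  have : nbhs x B by exact: open_nbhs_nbhs.
  move=> /H4[r r0 rB].
  have [k /(_ k (leqnn _)) kr] := exists_natSinv_lt r0.
  have [_] := Ix k I; apply => y By; rewrite leNgt; apply/negP => xy.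
  by apply: By; apply: rB => /=; exact: lt_trans kr.
by exists (F n), B; split.
Qed.

(** The regular sets form a sigma-algebra.  For a countable union, all the open
    approximations are kept, but only finitely many closed ones, since a
    countable union of closed sets need not be closed. *)
Lemma borel_regular (B : set (borel T)) : measurable B -> closed_open_regular B.
Proof.
move: B; apply: smallest_sub; last by move=> B; exact: open_regular.
split.
- by apply: open_regular; exact: open0.
- move=> A rA e /rA[F [U [cF oU FA AU UF]]]; exists (~` U), (~` F); split.
  + exact: open_closedC.
  + exact: closed_openC.
  + by move=> x Ux; split => // /AU.
  + by move=> x [_ Ax] /FA.
  + by rewrite setDE setCK setIC -setDE.
move=> A rA e e0.
have e20 : (0 < e / 2)%R by rewrite divr_gt0.
have /choice[FU FUP] : forall n, exists FU : set T * set T,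
    [/\ closed FU.1, open FU.2, FU.1 `<=` A n, A n `<=` FU.2 &
      nu (FU.2 `\` FU.1) < ((e / 2) / (2 ^ n.+1)%:R)%:E].
  move=> n; have [|F [U [? ? ? ?]]] := rA n ((e / 2) / (2 ^ n.+1)%:R)%R.
    by rewrite divr_gt0// ltr0n expn_gt0.
  by exists (F, U).
pose F n := (FU n).1; pose U n := (FU n).2.
have cF n : closed (F n) by case: (FUP n).
have oU n : open (U n) by case: (FUP n).
have mF n : measurable (F n : set (borel T)) by exact: borel_closed.
have mU n : measurable (U n : set (borel T)) by exact: borel_open.
pose W := \bigcup_n U n.
have oW : open W by exact: bigcup_open.
have [N NP] : exists N, nu (W `\` \big[setU/set0]_(i < N) F i) < e%:E.
  apply: (@measure_cap_small _ _ _ _ _ (e / 2)%:E).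
  - move=> n; apply: measurableD; first exact: borel_open.
    exact: bigsetU_measurable.
  - move=> m n mn; apply/subsetPset; apply: setDS.
    exact: subset_bigsetU.
  - apply: le_trans (epsilon_trick0 xpredT (ltW e20)).
    apply: (@le_trans _ _ (\sum_(n <oo) nu (U n `\` F n))).
      apply: measure_sigma_subadditive.
      + by move=> n; exact: measurableD.
      + apply: bigcapT_measurable => n; apply: measurableD.
          exact: borel_open.
        exact: bigsetU_measurable.
      + move=> x Ix; have [[n _ Unx] _] := Ix 0%N I; exists n => //.
        split => // Fnx; have [_] := Ix n.+1 I; apply.
        by rewrite big_ord_recr/=; right.
    apply: lee_nneseries => [n _ _|n _]; first exact: measure_ge0.
    by apply: ltW; case: (FUP n).
  - by rewrite lte_fin; rewrite ltr_pdivrMr// ltr_pMr// ltr1n.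
exists (\big[setU/set0]_(i < N) F i), W; split => //.
- exact: closed_bigsetU.
- move=> x; rewrite -bigcup_mkord => -[n /= _ Fnx]; exists n => //.
  by case: (FUP n) => _ _ + _ _; apply.
- by move=> x [n _ Anx]; exists n => //; case: (FUP n) => _ _ _ + _; apply.
Qed.

End regularity.

Definition cauchy_complete (R : realType) (T : topologicalType)
    (dist : T -> T -> R) := forall u : nat -> T,
  (forall e : R, (0 < e)%R -> exists N : nat, forall m n : nat,
     (N <= m)%N -> (N <= n)%N -> (dist (u m) (u n) < e)%R) ->
  exists l : T, u @ \oo --> l.

Lemma ultra_bigsetU (T : Type) (F : set_system T) (I : eqType) (s : seq I)
    (B : I -> set T) :
  UltraFilter F -> F (\big[setU/set0]_(i <- s) B i) ->
  exists2 i, i \in s & F (B i).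
Proof.
move=> FU; elim: s => [|i s ih]; first by rewrite big_nil => /filter_ex[].
rewrite big_cons => FB; have [FBi|FBi] := in_ultra_setVsetC (B i) FU.
  by exists i => //; rewrite mem_head.
have [|j js FBj] := ih; last by exists j => //; rewrite in_cons js orbT.
by apply: filterS (filterI FB FBi) => x [[]].
Qed.

Section tightness.
Context (R : realType) (T : topologicalType) (dist : T -> T -> R).
Hypothesis distP : metrizes dist.
Hypothesis completeP : cauchy_complete dist.

(** An ultrafilter on the set contains, for each m, a ball of radius
    1/(m+1).  Two such balls always meet, so their centres form a Cauchy
    sequence, to whose limit the ultrafilter converges. *)
Lemma totally_bounded_compact (K : set T) : closed K ->
  (forall m : nat, exists s : seq T,
    K `<=` \big[setU/set0]_(x <- s) [set y | (dist x y <= m.+1%:R^-1)%R]) ->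
  compact K.
Proof.
move=> cK tbK; rewrite compact_ultra => F FU FK.
have [H1 H2 H3 H4] := distP.
have /choice[x xP] : forall m : nat, exists x,
    F [set y | (dist x y <= m.+1%:R^-1)%R].
  move=> m; have [s Ks] := tbK m.
  have [|x _ Fx] := @ultra_bigsetU _ F _ s
    (fun x => [set y | (dist x y <= m.+1%:R^-1)%R]) FU.
    exact: filterS Ks FK.
  by exists x.
have [l xl] : exists l : T, x @ \oo --> l.
  apply: completeP => e e0.
  have [N NP] := exists_natSinv_lt (divr_gt0 e0 (ltr0n R 2)).
  exists N => m n Nm Nn.
  have [y [/= xmy xny]] := filter_ex (filterI (xP m) (xP n)).
  rewrite (le_lt_trans (H3 _ y _))// (splitr e) (H2 y) ltrD//.
    by rewrite (le_lt_trans xmy)// NP.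
  by rewrite (le_lt_trans xny)// NP.
have Fl : F --> l.
  move=> A /H4[e e0 eA].
  have e20 : (0 < e / 2)%R by rewrite divr_gt0.
  have [N NP] := exists_natSinv_lt e20.
  have : nbhs l [set y | (dist l y < e / 2)%R] by apply/H4; exists (e / 2)%R.
  move=> /xl[M _ MP].
  pose n := maxn N M.
  apply: filterS (xP n) => y /= xny; apply: eA => /=.
  rewrite (le_lt_trans (H3 _ (x n) _))// (splitr e) ltrD//.
    by apply: MP => /=; rewrite leq_maxr.
  by rewrite (le_lt_trans xny)// NP// leq_maxl.
exists l; split => //; apply: cK => A lA.
by have [y [Ky Ay]] := filter_ex (filterI FK (Fl _ lA)); exists y.
Qed.

End tightness.

Section inner_regularity.
Context (R : realType) (T : ptopologicalType) (dist : T -> T -> R).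
Hypothesis distP : metrizes dist.
Hypothesis completeP : cauchy_complete dist.
Hypothesis sepT : separable_space T.
Variable nu : probability (borel T) R.

(** At each scale 1/(m+1), finitely many balls carry almost all the mass.  The
    intersection over the scales is closed and totally bounded. *)
Lemma polish_tight (e : R) : (0 < e)%R ->
  exists K : set T, [/\ compact K, closed K & nu (~` K) < e%:E].
Proof.
move=> e0; have e20 : (0 < e / 2)%R by rewrite divr_gt0.
have [H1 H2 H3 H4] := distP.
have [U [oU bU]] := metrizes_countable_base distP sepT.
pose x n := xget point (U n).
have xP y (r : R) : (0 < r)%R -> exists n, (dist (x n) y < r)%R.
  move=> r0; have yr : [set z | (dist y z < r)%R] y.
    by rewrite /= (metrizes_xx distP).
  have [n Uny Unr] := bU _ _ (metrizes_open_lt distP y r) yr.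
  by exists n; rewrite H2; apply: Unr; apply: xgetPex; exists y.
pose B m i := [set y | (dist (x i) y <= m.+1%:R^-1)%R].
have cB m i : closed (B m i) by exact: metrizes_closed_le.
have /choice[N NP] : forall m, exists N,
    nu (~` (\big[setU/set0]_(i < N) B m i)) < ((e / 2) / (2 ^ m.+1)%:R)%:E.
  move=> m; apply: (@measure_cap_small _ _ _ _ _ 0).
  - move=> n; apply: measurableC; apply: bigsetU_measurable => i _.
    exact: borel_closed.
  - by move=> k n kn; apply/subsetPset; apply: subsetC; exact: subset_bigsetU.
  - rewrite (_ : \bigcap_n _ = set0) ?measure0//.
    apply/seteqP; split => // y /= Iy.
    have m0 : (0 < m.+1%:R^-1 :> R)%R by rewrite invr_gt0.
    have [n yn] := xP y _ m0.
    by have := Iy n.+1 I; apply; rewrite big_ord_recr/=; right; exact: ltW.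
  - by rewrite lte_fin divr_gt0// ltr0n expn_gt0.
pose K := \bigcap_m (\big[setU/set0]_(i < N m) B m i).
have cK : closed K by apply: closed_bigI => m _; exact: closed_bigsetU.
exists K; split => //.
  apply: (totally_bounded_compact distP completeP) => // m.
  exists [seq x i | i <- iota 0 (N m)]; rewrite big_map => y /(_ m I).
  by rewrite -(big_mkord xpredT) /index_iota subn0.
apply: (@le_lt_trans _ _ (e / 2)%:E); last first.
  by rewrite lte_fin; rewrite ltr_pdivrMr// ltr_pMr// ltr1n.
apply: le_trans (epsilon_trick0 xpredT (ltW e20)).
apply: (@le_trans _ _
  (\sum_(m <oo) nu (~` (\big[setU/set0]_(i < N m) B m i)))).
  apply: measure_sigma_subadditive.
  - move=> m; apply: measurableC; apply: bigsetU_measurable => i _.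
    exact: borel_closed.
  - by apply: measurableC; exact: borel_closed.
  - by rewrite /K setC_bigcap.
apply: lee_nneseries => [n _ _|n _]; first exact: measure_ge0.
by apply: ltW; exact: NP.
Qed.

(** Intersect the closed approximation from inside with a compact set of almost
    full mass. *)
Lemma polish_inner_regular (B : set (borel T)) (e : R) : measurable B ->
  (0 < e)%R -> exists K : set T,
    [/\ compact K, closed K, K `<=` B & nu (B `\` K) < e%:E].
Proof.
move=> mB e0; have e20 : (0 < e / 2)%R by rewrite divr_gt0.
have [K [kK cK Ke]] := polish_tight e20.
have [F [U [cF oU FB BU UFe]]] := borel_regular distP nu mB e20.
have mK : measurable (K : set (borel T)) by exact: borel_closed.
have mF : measurable (F : set (borel T)) by exact: borel_closed.
have mU : measurable (U : set (borel T)) by exact: borel_open.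
exists (K `&` F); split; last 2 first.
- by move=> x [_ /FB].
- apply: (@le_lt_trans _ _ (nu ((U `\` F) `|` ~` K))).
    apply: le_measure; rewrite ?inE.
    + by apply: measurableD => //; exact: measurableI.
    + by apply: measurableU; [exact: measurableD|exact: measurableC].
    + move=> x [Bx KFx]; have [Kx|] := pselect (K x); last by right.
      by left; split; [exact: BU|move=> Fx; exact: KFx].
  apply: (@le_lt_trans _ _ (nu (U `\` F) + nu (~` K))).
    by apply: measureU2; [exact: measurableD|exact: measurableC].
  by rewrite (splitr e) EFinD lteD.
- by apply: (@subclosed_compact _ _ K) => //; exact: closedI.
- exact: closedI.
Qed.

End inner_regularity.

(** * Measures with prescribed values on rectangles *)

Definition push d1 d2 (T1 : measurableType d1) (T2 : measurableType d2)
    (R : realType) (P : probability T1 R) (f : T1 -> T2)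
    (mf : measurable_fun setT f) : probability T2 R :=
  distribution P (HB.pack f (isMeasurableFun.Build _ _ _ _ f mf) :
                    {mfun T1 >-> T2}).

Lemma pushE d1 d2 (T1 : measurableType d1) (T2 : measurableType d2)
    (R : realType) (P : probability T1 R) (f : T1 -> T2)
    (mf : measurable_fun setT f) A : push P mf A = P (f @^-1` A).
Proof. by []. Qed.

(** Rectangles are stable under intersection and generate the product
    sigma-algebra. *)
Lemma prob_rect_unique (R : realType) d1 d2 (T1 : measurableType d1)
    (T2 : measurableType d2) (P Q : probability (T1 * T2)%type R) :
  (forall A B, measurable A -> measurable B -> P (A `*` B) = Q (A `*` B)) ->
  forall S, measurable S -> P S = Q S.
Proof.
move=> PQ S mS.
apply: (measure_unique [set A `*` B | A in measurable & B in measurable]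
  (fun=> setT)) => //.
- exact: measurable_prod_measurableType.
- move=> _ _ [A mA [A' mA' <-]] [B mB [B' mB' <-]].
  exists (A `&` B); first exact: measurableI.
  exists (A' `&` B'); first exact: measurableI.
  by rewrite setXI.
- by move=> n; exists setT => //; exists setT => //; rewrite setXTT.
- by rewrite bigcup_const.
- by move=> _ [A mA [B mB <-]]; exact: PQ.
- by move=> n; apply: (le_lt_trans (probability_le1 P measurableT)); rewrite ltry.
Qed.

Section rectangles.
Context d1 d2 (E : measurableType d1) (T : measurableType d2).

(** A copy of the product type, on which the measurable sets are only the
    rectangles: the semiring to which Caratheodory's theorem is applied. *)
Definition rectangles_type := (E * T)%type.
HB.instance Definition _ := Pointed.on rectangles_type.

Definition rectangle (S : set rectangles_type) :=
  exists A B, [/\ measurable A, measurable B & S = A `*` B].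

Let rectangle0 : rectangle set0.
Proof. by exists set0, set0; rewrite setX0. Qed.

Let rectangleI : setI_closed rectangle.
Proof.
move=> _ _ [A [B [mA mB ->]]] [A' [B' [mA' mB' ->]]].
exists (A `&` A'), (B `&` B'); rewrite -setXI; split => //; exact: measurableI.
Qed.

Let rectangleD : semi_setD_closed rectangle.
Proof.
move=> _ _ [A [B [mA mB ->]]] [A' [B' [mA' mB' ->]]].
exists [set (A `\` A') `*` B; (A `&` A') `*` (B `\` B')]; split.
- by [].
- move=> _ [->|->]; [exists (A `\` A'), B|exists (A `&` A'), (B `\` B')];
    by split => //; (exact: measurableD || exact: measurableI).
- apply/seteqP; split => [[x y] /= [[Ax By] /not_andP ABxy]|].
    have [A'x|A'x] := pselect (A' x); last first.
      by exists ((A `\` A') `*` B); [left|].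
    exists ((A `&` A') `*` (B `\` B')); first by right.
    by split => //; split => //; case: ABxy.
  by move=> [x y] [_ [->|->]] /= [] [? ?] => [?|[? ?]]; split => // -[].
- move=> _ _ [->|->] [->|->] //= [[x y] [[[? ?] ?] [[? ?] ?]]] //.
Qed.

HB.instance Definition _ := isSemiRingOfSets.Build default_measure_display
  rectangles_type rectangle0 rectangleI rectangleD.

Lemma g_sigma_rectangles :
  @measurable _ (E * T)%type = <<s (@measurable _ rectangles_type) >>.
Proof.
rewrite measurable_prod_measurableType; congr (<<s _ >>).
apply/seteqP; split => [_ [A mA] [B mB <-]|_ [A [B [mA mB ->]]]].
  by exists A, B.
by exists A => //; exists B.
Qed.

End rectangles.

Section rectangle_extension.
Context (R : realType) d (E : measurableType d) (T : ptopologicalType).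
Variables (mu : probability E R) (nu : probability (borel T) R).
Variable m : set (rectangles_type E (borel T)) -> \bar R.
Hypothesis nuK : forall (B : set (borel T)) (e : R), measurable B ->
  (0 < e)%R -> exists K : set T,
    [/\ compact K, closed K, K `<=` B & nu (B `\` K) < e%:E].
Hypothesis m_ge0 : forall S, 0 <= m S.
Hypothesis m_add : measure_function.semi_additive m.
Hypothesis m_mu : forall A, measurable A -> m (A `*` setT) = mu A.
Hypothesis m_nu : forall B, measurable B -> m (setT `*` B) = nu B.

Let mc : {content set (rectangles_type E (borel T)) -> \bar R} :=
  HB.pack m (isContent.Build _ _ R m m_ge0 m_add).

Let rect A (B : set (borel T)) : measurable A -> measurable B ->
  measurable (A `*` B : set (rectangles_type E (borel T))).
Proof. by exists A, B. Qed.

Let m_le2 (A A1 A2 : set E) (B B1 B2 : set (borel T)) : measurable A -> measurable B ->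
  measurable A1 -> measurable B1 -> measurable A2 -> measurable B2 ->
  A `*` B `<=` A1 `*` B1 `|` A2 `*` B2 ->
  m (A `*` B) <= m (A1 `*` B1) + m (A2 `*` B2).
Proof.
move=> mA mB mA1 mB1 mA2 mB2 sub.
pose F n : set (rectangles_type E (borel T)) :=
  if n is 0%N then A1 `*` B1 else A2 `*` B2.
have := @content_subadditive _ _ _ mc (A `*` B) F 2%N.
rewrite big_ord_recr /= big_ord_recr /= big_ord0 set0U.
rewrite !big_ord_recr/= big_ord0 add0e; apply.
- by move=> [|k] _; exact: rect.
- exact: rect.
- exact: sub.
Qed.

Let outer (B : set (borel T)) (e : R) : measurable B -> (0 < e)%R ->
  exists U : set T, [/\ open U, B `<=` U & nu (U `\` B) < e%:E].
Proof.
move=> mB /(nuK (measurableC mB))[K [_ cK KB Ke]].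
exists (~` K); split; first exact: closed_openC.
  by move=> x Bx /KB.
by rewrite setDE setIC -setDE.
Qed.

(** Let the rectangles [A_n `*` B_n] cover [A `*` B].  Shrink [B] to a compact
    [K] and enlarge each [B_n] to an open [U_n], at a small cost in the marginal
    [nu].  Above a point of [A], finitely many [U_n] cover [K].  The set [G N] of
    the points for which the first [N] rectangles suffice increases to [A], so
    [A] minus [G N] has small [mu] measure, and [G N `*` K] is covered by finitely
    many rectangles, where finite subadditivity is enough. *)
Let m_sigma_subadditive : measurable_subset_sigma_subadditive m.
Proof.
move=> S F mF [A [B [mA mB ->{S}]]] ABF.
have /choice[AB ABP] : forall n, exists AB : set E * set (borel T),
    [/\ measurable AB.1, measurable AB.2 & F n = AB.1 `*` AB.2].
  by move=> n; have [A' [B' [? ? ?]]] := mF n; exists (A', B').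
apply/lee_addgt0Pr => e e0.
have e30 : (0 < e / 3)%R by rewrite divr_gt0.
have [K [kK cK KB Ke]] := nuK mB e30.
have mK : measurable (K : set (borel T)) by exact: borel_closed.
have /choice[U UP] : forall n, exists U : set T,
    [/\ open U, (AB n).2 `<=` U &
      nu (U `\` (AB n).2) < ((e / 3) / (2 ^ n.+1)%:R)%:E].
  move=> n; have [_ mB' _] := ABP n; apply: outer => //.
  by rewrite divr_gt0// ltr0n expn_gt0.
have oU n : open (U n) by case: (UP n).
have mU n : measurable (U n : set (borel T)) by exact: borel_open.
pose G N := [set x | A x /\
  K `<=` \bigcup_(n in [set n | (n < N)%N /\ (AB n).1 x]) U n].
have mG N : measurable (G N).
  (* G N is measurable because whether its condition holds at x only depends on
     which of the first N sets A_n contain x. *)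
  pose good (s : {set 'I_N}) := K `<=` \bigcup_(n in [set` s]) U n.
  rewrite (_ : G N = A `&` \bigcup_(s in good)
      \bigcap_(n in [set n : 'I_N | n \in s]) (AB n).1).
    apply: measurableI => //; apply: fin_bigcup_measurable.
      exact: finite_finset.
    move=> s _; apply: fin_bigcap_measurable; first exact: finite_finset.
    by move=> n _; case: (ABP n).
  apply/seteqP; split => x [Ax].
    move=> Kx; split => //; exists [set n : 'I_N | `[< (AB n).1 x >] ]%SET.
      move=> y /Kx[n [/= nN ABx] Uny].
      by exists (Ordinal nN) => //=; rewrite inE; exact/asboolP.
    by move=> n /=; rewrite inE => /asboolP.
  move=> [s Ks xs]; split => // y /Ks[n /= ns Uny].
  by exists n => //=; split => //; exact: xs.
have [N NP] : exists N, mu (A `\` G N) < (e / 3)%:E.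
  apply: (@measure_cap_small _ _ _ mu _ 0).
  - by move=> n; exact: measurableD.
  - move=> i j ij; apply/subsetPset; apply: setDS => x [Ax Kx]; split => //.
    by move=> y /Kx[n [/= ni ABx] Uy]; exists n => //=; split => //; exact: leq_trans ij.
  - rewrite (_ : \bigcap_n _ = set0) ?measure0//.
    apply/seteqP; split => // x /= Ix.
    have Ax : A x by have [] := Ix 0%N I.
    have := kK; rewrite compact_cover.
    move=> /(_ nat [set n | (AB n).1 x] U)[].
    + by move=> n _; exact: oU.
    + move=> y Ky; have [n _ +] := ABF (x, y) (conj Ax (KB _ Ky)).
      case: (ABP n) => _ _ -> /= [ABx By]; exists n => //.
      by case: (UP n) => _ + _; apply.
    + move=> D DA KD.
      pose N := (\max_(n <- finmap.enum_fset D) n)%N.+1.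
      have [_] := Ix N I; apply; split => // y /KD[n /= nD Uny].
      exists n => //=; split; last by have := DA _ nD; rewrite inE.
      by rewrite ltnS; exact: (@leq_bigmax_seq _ _ xpredT id).
  - by rewrite lte_fin.
have mAB1 n : measurable (AB n).1 by case: (ABP n).
have mAB2 n : measurable (AB n).2 by case: (ABP n).
(* Three errors of size e/3 are made: from B to K, from A to G N, and from the
   B_n to the U_n altogether. *)
have step1 : m (A `*` B) <= m (A `*` K) + (e / 3)%:E.
  apply: (@le_trans _ _ (m (A `*` K) + m (setT `*` (B `\` K)))).
    apply: m_le2 => //; first exact: measurableD.
    move=> [x y] [/= Ax By]; have [Ky|Ky] := pselect (K y); first by left.
    by right.
  by apply: leeD => //; rewrite m_nu ?ltW//; exact: measurableD.
have step2 : m (A `*` K) <= m (G N `*` K) + (e / 3)%:E.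
  apply: (@le_trans _ _ (m (G N `*` K) + m ((A `\` G N) `*` setT))).
    apply: m_le2 => //; first exact: measurableD.
    move=> [x y] [/= Ax By]; have [Gx|Gx] := pselect (G N x); first by left.
    by right.
  by apply: leeD => //; rewrite m_mu ?ltW//; exact: measurableD.
have step3 : m (G N `*` K) <= \sum_(n < N) m ((AB n).1 `*` U n).
  apply: (@content_subadditive _ _ _ mc _ (fun n => (AB n).1 `*` U n)).
  - by move=> n _; exact: rect.
  - exact: rect.
  - move=> [x y] [/= [Ax Kx] /Kx [n [/= nN ABx] Uy]].
    have : (\bigcup_(k in `I_N) ((AB k).1 `*` U k)) (x, y) by exists n.
    by rewrite bigcup_mkord.
have step4 : \sum_(n < N) m ((AB n).1 `*` U n) <=
    \sum_(n <oo) (m (F n) + ((e / 3) / (2 ^ n.+1)%:R)%:E).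
  apply: (@le_trans _ _
      (\sum_(0 <= n < N) (m (F n) + ((e / 3) / (2 ^ n.+1)%:R)%:E))).
    rewrite big_mkord; apply: lee_sum => n _.
    case: (ABP n) => _ _ ->; case: (UP n) => _ BU Ue.
    apply: (@le_trans _ _ (m ((AB n).1 `*` (AB n).2) +
        m (setT `*` (U n `\` (AB n).2)))).
      apply: m_le2 => //; first exact: measurableD.
      move=> [x y] [/= Ax By]; have [By'|By'] := pselect ((AB n).2 y).
        by left.
      by right.
    by apply: leeD => //; rewrite m_nu ?ltW//; exact: measurableD.
  apply: nneseries_lim_ge => n _ _.
  by rewrite adde_ge0// lee_fin divr_ge0// ltW.
have step5 := @epsilon_trick R (m \o F) (e / 3)%R xpredT (fun n => m_ge0 (F n)) (ltW e30).
apply: (le_trans step1).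
have -> : e%:E = (e / 3)%:E + ((e / 3)%:E + (e / 3)%:E).
  by rewrite -!EFinD; congr (_%:E); lra.
rewrite addeA addeA; apply: leeD => //; apply: (le_trans step2).
apply: leeD => //.
exact: (le_trans step3 (le_trans step4 step5)).
Qed.

Let mm : {measure set (rectangles_type E (borel T)) -> \bar R} :=
  HB.pack (Content.sort mc)
    (Content_SigmaSubAdditive_isMeasure.Build _ R _ (Content.sort mc)
       m_sigma_subadditive).

(** The assumption [nuK] is inner regularity for compact sets, which every
    probability on a Polish space has. *)
Lemma rectangle_extension :
  exists pi : probability (E * borel T)%type R,
    forall A B, measurable A -> measurable B -> pi (A `*` B) = m (A `*` B).
Proof.
have extE A B : measurable A -> measurable B ->
    measure_extension mm (A `*` B) = m (A `*` B).
  by move=> mA mB; apply: (measurable_mu_extE mm); exact: rect.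
have ext1 : measure_extension mm setT = 1.
  by rewrite -setXTT extE// m_mu// probability_setT.
pose P : probability _ R := HB.pack (measure_extension mm)
  (Measure_isProbability.Build _ _ _ (measure_extension mm) ext1).
have mid : measurable_fun [set: g_sigma_algebraType
    (@measurable _ (rectangles_type E (borel T)))]
    (id : _ -> (E * borel T)%type).
  by move=> _ S; rewrite setTI g_sigma_rectangles preimage_id.
by exists (push P mid) => A B mA mB; rewrite pushE preimage_id; exact: extE.
Qed.

End rectangle_extension.

Lemma polish_rectangle_extension (R : realType) d (E : measurableType d)
    (T : ptopologicalType) (mu : probability E R) (nu : probability (borel T) R)
    (m : set (rectangles_type E (borel T)) -> \bar R) :
  polish R T -> (forall S, 0 <= m S) -> measure_function.semi_additive m ->
  (forall A, measurable A -> m (A `*` setT) = mu A) ->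
  (forall B, measurable B -> m (setT `*` B) = nu B) ->
  exists pi : probability (E * borel T)%type R,
    forall A B, measurable A -> measurable B -> pi (A `*` B) = m (A `*` B).
Proof.
move=> [sepT [dist [H1 H2 H3 H4 H5]]]; apply: rectangle_extension => B e mB e0.
by apply: (@polish_inner_regular _ _ dist).
Qed.

(** * Gluing two couplings along a common marginal *)

Lemma bigsetU_ordP (T : Type) n (D : 'I_n -> set T) x :
  (\big[setU/set0]_(k < n) D k) x <-> exists k, D k x.
Proof.
rewrite -bigcup_seq; split => [[k _ Dx]|[k Dx]]; exists k => //=.
exact: mem_index_enum.
Qed.

Section conditional_density.
Context (R : realType) d2 d3 (Y : measurableType d2) (Z : measurableType d3).
Variables (rho : probability (Y * Z)%type R) (mu : probability Y R).
Hypothesis rho_mu : forall B, measurable B -> rho (B `*` setT) = mu B.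

(** The cases where [C] is not measurable or is empty are included so that one
    choice function covers all sets and gives the zero function, rather than an almost zero one, to the empty
    set. *)
Lemma conditional_density_exists (C : set Z) : exists f : Y -> \bar R,
  [/\ (forall y, 0 <= f y), measurable_fun setT f,
      (measurable C -> mu.-integrable setT f /\ forall B, measurable B ->
         rho (B `*` C) = \int[mu]_(y in B) f y) &
      (C = set0 -> f = cst 0)].
Proof.
have [->|C0] := eqVneq C set0.
  exists (cst 0); split => //.
  move=> _; split; first exact: integrable0.
  by move=> B mB; rewrite setX0 measure0 integral0.
have [mC|mC] := pselect (measurable C); last first.
  by exists (cst 0); split.
pose nu (B : set Y) := rho (B `*` C).
have nu0 : nu set0 = 0 by rewrite /nu set0X measure0.
have nu_ge0 B : 0 <= nu B by exact: measure_ge0.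
have nu_sa : semi_sigma_additive nu.
  move=> F mF tF mUF; rewrite /nu setX_bigcupl.
  apply: measure_semi_sigma_additive.
  - by move=> n; exact: measurableX.
  - apply/trivIsetP => i j _ _ ij; rewrite -setXI.
    by move/trivIsetP : tF => /(_ _ _ I I ij) ->; rewrite set0X.
  - by apply: bigcupT_measurable => n; exact: measurableX.
have nu_fin : fin_num_fun nu.
  by move=> B mB; apply: fin_num_measure; exact: measurableX.
pose nu0' := isMeasure.Build _ _ _ nu nu0 nu_ge0 nu_sa.
pose nuM : {measure set Y -> \bar R} := HB.pack nu nu0'.
pose nuF : {finite_measure set Y -> \bar R} :=
  HB.pack (Measure.sort nuM) (Measure_isFinite.Build _ _ _ (Measure.sort nuM) nu_fin).
have numu : nuF `<< mu.
  apply/null_content_dominatesP => B mB muB.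
  apply: (@subset_measure0 _ _ _ rho _ (B `*` setT)).
  - exact: measurableX.
  - exact: measurableX.
  - by move=> [y z] [].
  - exact: etrans (rho_mu mB) muB.
pose f := Radon_Nikodym_SigmaFinite.f nuF mu.
have fi : mu.-integrable setT f by exact: Radon_Nikodym_SigmaFinite.f_integrable.
exists f; split.
- exact: Radon_Nikodym_SigmaFinite.f_ge0.
- exact: measurable_int fi.
- move=> _; split => // B mB.
  by rewrite -(Radon_Nikodym_SigmaFinite.f_integral numu mB).
- by move/eqP; rewrite (negbTE C0).
Qed.

(** The conditional probability of [C] given the point of [Y], chosen for each
    [C] independently of the others. *)
Definition conditional_density (C : set Z) : Y -> \bar R :=
  projT1 (cid (conditional_density_exists C)).
Local Notation f := conditional_density.

Lemma conditional_density_ge0 C y : 0 <= f C y.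
Proof. by rewrite /f; case: cid => ? [] /=. Qed.

Lemma measurable_conditional_density C : measurable_fun setT (f C).
Proof. by rewrite /f; case: cid => ? [] /=. Qed.

Lemma conditional_density_integrable C : measurable C ->
  mu.-integrable setT (f C).
Proof. by rewrite /f; case: cid => ? [? ? H ?] /= /H[]. Qed.

Lemma conditional_density_integral C B : measurable C -> measurable B ->
  rho (B `*` C) = \int[mu]_(y in B) f C y.
Proof. by rewrite /f; case: cid => ? [? ? H ?] /= /H[_]; apply. Qed.

Lemma conditional_density0 : f set0 = cst 0.
Proof. by rewrite /f; case: cid => ? [? ? ? H] /=; exact: H. Qed.

Lemma conditional_densityT : ae_eq mu setT (f setT) (cst 1).
Proof.
apply: integral_ae_eq => //; first exact: conditional_density_integrable.
move=> B _ mB; rewrite -conditional_density_integral// rho_mu//.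
by rewrite integral_cst// mul1e.
Qed.

(** Additivity only holds outside a null set that depends on the family; this
    is harmless for finitely many families. *)
Lemma conditional_density_additive n (D : 'I_n -> set Z) :
  (forall k, measurable (D k)) -> trivIset setT D ->
  ae_eq mu setT (f (\big[setU/set0]_(k < n) D k))
    (fun y => \sum_(k < n) f (D k) y).
Proof.
move=> mD tD; have mU : measurable (\big[setU/set0]_(k < n) D k).
  exact: bigsetU_measurable.
apply: integral_ae_eq => //.
- exact: conditional_density_integrable.
- by apply: emeasurable_sum => k; exact: measurable_conditional_density.
move=> B _ mB; rewrite -conditional_density_integral//.
rewrite ge0_integral_sum//; last 2 first.
- by move=> k; apply: measurable_funTS; exact: measurable_conditional_density.
- by move=> k y _; exact: conditional_density_ge0.
rewrite (_ : B `*` _ = \big[setU/set0]_(k < n) (B `*` D k)); last first.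
  apply/seteqP; split => [[y z] [/= By /bigsetU_ordP[k Dz]]|[y z]].
    by apply/bigsetU_ordP; exists k.
  by move=> /bigsetU_ordP[k [/= By Dz]]; split => //; apply/bigsetU_ordP; exists k.
rewrite measure_bigsetU_ord//.
- by apply: eq_bigr => k _; exact: conditional_density_integral.
- by move=> k; exact: measurableX.
- move=> i j _ _ [[y z] [[/= _ Di] [_ Dj]]]; apply: tD => //.
  by exists z.
Qed.

End conditional_density.

Section gluing.
Context (R : realType) d1 d2 (E : measurableType d1) (Y : measurableType d2).
Context (Z : ptopologicalType).
Hypothesis polishZ : polish R Z.
Variables (P : probability E R) (q : E -> Y).
Hypothesis mq : measurable_fun setT q.
Variable rho : probability (Y * borel Z)%type R.
Hypothesis rho_mu : forall B, measurable B ->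
  rho (B `*` setT) = push P mq B.
Local Notation f := (conditional_density rho_mu).

(** The integral of the conditional probabilities of the sections.  Going
    through sections gives a value to every set, not only to rectangles, and
    reduces additivity to a pointwise statement. *)
Let m (S : set (rectangles_type E (borel Z))) : \bar R :=
  \int[P]_e f (xsection S e) (q e).

Let m_rect A C : measurable A -> measurable C ->
  m (A `*` C) = \int[P]_(e in A) f C (q e).
Proof.
move=> mA mC; rewrite [RHS]integral_mkcond; apply: eq_integral => e _.
rewrite patchE; case: ifPn => eA; first by rewrite in_xsectionX.
by rewrite notin_xsectionX// conditional_density0.
Qed.

Let measurable_f C : measurable_fun setT (f C \o q).
Proof. by apply: measurableT_comp => //; exact: measurable_conditional_density. Qed.

Let ae_push (Q : set Y) : (\forall y \ae push P mq, Q y) ->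
  \forall e \ae P, Q (q e).
Proof.
move=> [N [mN N0 QN]]; exists (q @^-1` N); split => //.
  by rewrite -[X in measurable X]setTI; exact: mq.
by move=> e /= Qe; exact: QN.
Qed.

Let m_rho B C : measurable B -> measurable C ->
  m ((q @^-1` B) `*` C) = rho (B `*` C).
Proof.
move=> mB mC; have mqB : measurable (q @^-1` B).
  by rewrite -[X in measurable X]setTI; exact: mq.
rewrite m_rect// (conditional_density_integral rho_mu)//.
rewrite (@ge0_integral_pushforward _ _ _ _ _ _ mq P)//.
  by apply: measurable_funTS; exact: measurable_conditional_density.
by move=> y _; exact: conditional_density_ge0.
Qed.

(** For a fixed [e], the sections of the rectangles are disjoint sets, and which
    of them are nonempty only depends on the set [s] of the indices whose first
    side contains [e].  There are finitely many possible [s], so the densities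
    add up for all of them outside one null set. *)
Let m_additive : measure_function.semi_additive m.
Proof.
move=> F n mF tF mU; rewrite /m.
have /choice[AC ACP] : forall k, exists AC : set E * set (borel Z),
    [/\ measurable AC.1, measurable AC.2 & F k = AC.1 `*` AC.2].
  by move=> k; have [A [C [? ? ?]]] := mF k; exists (A, C).
have mA k : measurable (AC k).1 by case: (ACP k).
have mC k : measurable (AC k).2 by case: (ACP k).
have FE k : F k = (AC k).1 `*` (AC k).2 by case: (ACP k).
have fF k : (fun e => f (xsection (F k) e) (q e)) =
    ((fun e => f (AC k).2 (q e)) \_ (AC k).1).
  apply/funext => e; rewrite FE patchE; case: ifPn => eA.
    by rewrite in_xsectionX.
  by rewrite notin_xsectionX// conditional_density0.
have mfF k : measurable_fun setT (fun e => f (xsection (F k) e) (q e)).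
  rewrite fF; apply/(measurable_restrictT _ (mA k)).
  by apply: measurable_funTS; exact: measurable_f.
rewrite -ge0_integral_sum//; last first.
  by move=> k e _; exact: conditional_density_ge0.
apply: ae_eq_integral => //.
- case: mU => A [C [mA' mC' ->]].
  rewrite (_ : (fun e => _) = ((fun e => f C (q e)) \_ A)).
    apply/(measurable_restrictT _ mA').
    by apply: measurable_funTS; exact: measurable_f.
  apply/funext => e; rewrite patchE; case: ifPn => eA.
    by rewrite in_xsectionX.
  by rewrite notin_xsectionX// conditional_density0.
- by apply: emeasurable_sum => k; exact: mfF.
pose D (s : {set 'I_n}) k := if k \in s then (AC k).2 else set0.
have : \forall e \ae P, forall s : {set 'I_n}, trivIset setT (D s) ->
    f (\big[setU/set0]_(k < n) D s k) (q e) = \sum_(k < n) f (D s k) (q e).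
  apply: filter_forall => s; have [tD|?] := pselect (trivIset setT (D s)).
    have mD k : measurable (D s k) by rewrite /D; case: ifP.
    have := conditional_density_additive rho_mu mD tD.
    by move=> /ae_push; apply: filterS => e He _; exact: He.
  exact: aeW.
apply: filterS => e He _.
pose s := [set k : 'I_n | e \in (AC k).1]%SET.
have DE k : D s k = xsection (F k) e.
  rewrite FE /D inE; case: ifPn => eA; first by rewrite in_xsectionX.
  by rewrite notin_xsectionX.
have -> : xsection (\big[setU/set0]_(k < n) F k) e = \big[setU/set0]_(k < n) D s k.
  apply/seteqP; split => z.
    move=> /xsectionP/bigsetU_ordP[k Fz]; apply/bigsetU_ordP; exists k.
    by rewrite DE; exact/xsectionP.
  move=> /bigsetU_ordP[k]; rewrite DE => /xsectionP Fz.
  by apply/xsectionP/bigsetU_ordP; exists k.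
rewrite He.
  by apply: eq_bigr => k _; rewrite DE.
move=> i j _ _; rewrite !DE => ij; apply: ord_inj.
have tX : trivIset setT (fun k => xsection (F k) e).
  exact: trivIset_xsection.
exact: (tX _ _ I I ij).
Qed.

(** The measure [rho] is glued to [P] along [q], which in the application is the
    projection of a coupling to its second factor. *)
Lemma gluing : exists g : probability (E * borel Z)%type R,
  (forall A, measurable A -> g (A `*` setT) = P A) /\
  (forall B C, measurable B -> measurable C ->
     g ((q @^-1` B) `*` C) = rho (B `*` C)).
Proof.
have mrhoC : measurable_fun setT (snd : Y * borel Z -> borel Z).
  exact: measurable_snd.
have m_mu A : measurable A -> m (A `*` setT) = P A.
  move=> mA; rewrite m_rect// -[RHS]mul1e -(@integral_cst _ _ _ P _ mA).
  apply: ae_eq_integral => //.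
    by apply: measurable_funTS; exact: measurable_f.
  have := conditional_densityT rho_mu.
  by move=> /ae_push; apply: filterS => e He _; exact: He.
have m_nu B : measurable B -> m (setT `*` B) = push rho mrhoC B.
  move=> mB; rewrite pushE -(preimage_setT q) m_rho//.
  by congr (rho _); apply/seteqP; split => -[y z] //= [].
have m_ge0 S : 0 <= m S.
  by apply: integral_ge0 => e _; exact: conditional_density_ge0.
have [g gm] := polish_rectangle_extension polishZ m_ge0 m_additive m_mu m_nu.
exists g; split => [A mA|B C mB mC].
  by rewrite gm//; exact: m_mu.
rewrite gm//; first exact: m_rho.
by rewrite -[X in measurable X]setTI; exact: mq.
Qed.

End gluing.

(** * Limits of couplings along an ultrafilter *)

Section dynkin_limit.
Context (R : realType) d1 d2 (W : measurableType d1) (S : measurableType d2).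
Context (J : Type) (F : set_system J).
Variables (rho_ : J -> probability W R) (rho : probability W R).
Variables (kappa : probability S R) (g : W -> S) (D : set W).
Hypothesis mg : measurable_fun setT g.
Hypothesis mD : measurable D.
Hypothesis rho_kappa : forall i A, measurable A ->
  rho_ i (g @^-1` A) = kappa A.
Hypothesis rhoE : forall A, measurable A -> rho (g @^-1` A) = kappa A.

Let r (P : probability W R) A := fine (P (g @^-1` A `&` D)).

Let mgD A : measurable A -> measurable (g @^-1` A `&` D).
Proof.
by move=> mA; apply: measurableI => //; rewrite -[X in measurable X]setTI; exact: mg.
Qed.

Let rU P A B : measurable A -> measurable B -> A `&` B = set0 ->
  r P (A `|` B) = (r P A + r P B)%R.
Proof.
move=> mA mB AB; rewrite /r preimage_setU setIUl measureU; first 1 last.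
- exact: mgD.
- exact: mgD.
- by rewrite setIACA setIid -preimage_setI AB preimage_set0 set0I.
by rewrite fineD// fin_num_measure//; exact: mgD.
Qed.

Let r_ge0 P A : (0 <= r P A)%R.
Proof. by rewrite fine_ge0. Qed.

Let r_le (P : probability W R) A : measurable A ->
  (forall A, measurable A -> P (g @^-1` A) = kappa A) ->
  (r P A <= fine (kappa A))%R.
Proof.
move=> mA PA; have mgA : measurable (g @^-1` A).
  by rewrite -[X in measurable X]setTI; exact: mg.
rewrite -PA//; apply: fine_le; rewrite ?fin_num_measure//; first exact: mgD.
by apply: le_measure; rewrite ?inE//; exact: mgD.
Qed.

(** The sets for which convergence holds form a Dynkin system.  For a disjoint
    union, the tail has small [kappa] measure, and [kappa] bounds it uniformly in
    the index: this is where the common marginal is essential. *)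
Lemma dynkin_limit (G : set (set S)) : ProperFilter F ->
  @measurable _ S = <<s G >> -> setI_closed G ->
  fine (rho_ i D) @[i --> F] --> fine (rho D) ->
  (forall A, G A -> fine (rho_ i (g @^-1` A `&` D)) @[i --> F] -->
                    fine (rho (g @^-1` A `&` D))) ->
  forall A, measurable A -> fine (rho_ i (g @^-1` A `&` D)) @[i --> F] -->
                    fine (rho (g @^-1` A `&` D)).
Proof.
move=> FF GE GI convT convG A; rewrite GE; move: A.
have r_T P : r P setT = fine (P D) by rewrite /r preimage_setT setTI.
have r_0 P : r P set0 = 0%R by rewrite /r preimage_set0 set0I measure0.
have cT : r (rho_ i) setT @[i --> F] --> r rho setT.
  by rewrite r_T; under eq_fun do rewrite r_T.
pose conv A := r (rho_ i) A @[i --> F] --> r rho A.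
apply: (@dynkin_induction _ _ G conv) => //.
- move=> A mA convA.
  have rC P : r P (~` A) = (r P setT - r P A)%R.
    rewrite -(setUv A) rU ?setICr//; last exact: measurableC.
    by rewrite addrAC subrr add0r.
  rewrite /conv rC; under eq_fun do rewrite rC.
  exact: cvgB.
- move=> A mA tA convA.
  apply/cvgrPdist_lt => e e0.
  have e30 : (0 < e / 3)%R by rewrite divr_gt0.
  pose A_ N := \big[setU/set0]_(k < N) A k.
  have mA_ N : measurable (A_ N) by exact: bigsetU_measurable.
  have mUA : measurable (\bigcup_k A k) by exact: bigcupT_measurable.
  have [N NP] : exists N, kappa (\bigcup_k A k `\` A_ N) < (e / 3)%:E.
    apply: (@measure_cap_small _ _ _ kappa _ 0).
    + by move=> N; exact: measurableD.
    + move=> i j ij; apply/subsetPset; apply: setDS; exact: subset_bigsetU.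
    + rewrite (_ : \bigcap_n _ = set0) ?measure0//.
      apply/seteqP; split => // x Ix; have [[k _ Akx] _] := Ix 0%N I.
      have [_] := Ix k.+1 I; apply.
      by rewrite /A_ big_ord_recr/=; right.
    + by rewrite lte_fin.
  (* Finitely many pieces and a tail whose mass is below e/3, uniformly in P. *)
  have rE P : r P (\bigcup_k A k) =
      (r P (A_ N) + r P (\bigcup_k A k `\` A_ N))%R.
    rewrite -rU//; [|exact: measurableD|by rewrite setDIK].
    rewrite setDUK// => x; rewrite /A_ -bigcup_mkord => -[k _ Akx].
    by exists k.
  have kN : (fine (kappa (\bigcup_k A k `\` A_ N)) < e / 3)%R.
    rewrite -lte_fin fineK// fin_num_measure//; exact: measurableD.
  have conv_ n : r (rho_ i) (A_ n) @[i --> F] --> r rho (A_ n).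
    elim: n => [|n ih].
      rewrite /A_ big_ord0 r_0; under eq_fun do rewrite r_0.
      exact: cvg_cst.
    have rS P : r P (A_ n.+1) = (r P (A_ n) + r P (A n))%R.
      rewrite -rU// /A_ ?big_ord_recr// /A_ -bigcup_mkord setI_bigcupl.
      apply: bigcup0 => k /= kn; move/trivIsetP : tA; apply => //.
      by rewrite neq_ltn kn.
    rewrite rS; under eq_fun do rewrite rS.
    by apply: cvgD => //; exact: convA.
  near=> i.
  have H : (`|r rho (A_ N) - r (rho_ i) (A_ N)| < e / 3)%R.
    by near: i; move/cvgrPdist_lt: (conv_ N); exact.
  have mD' := measurableD mUA (mA_ N).
  have H1 := r_le mD' rhoE.
  have H2 := r_le mD' (rho_kappa i).
  rewrite !rE; move: H H1 H2.
  have := r_ge0 rho (\bigcup_k A k `\` A_ N).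
  have := r_ge0 (rho_ i) (\bigcup_k A k `\` A_ N).
  move: kN; rewrite !ltr_norml => ? ? ? /andP[? ?] ? ?; apply/andP; split; lra.
Unshelve. all: by end_near. Qed.

End dynkin_limit.

Lemma ultra_fmap (T U : Type) (f : T -> U) (F : set_system T) :
  UltraFilter F -> UltraFilter (f @ F).
Proof.
move=> FU; split; first exact: fmap_proper_filter.
move=> G GP FG; apply/seteqP; split => // A GA.
have [//|FnA] := in_ultra_setVsetC (f @^-1` A) FU.
have /FG GnA : (f @ F) (~` A) by [].
by have [x []] := filter_ex (filterI GA GnA).
Qed.

Section ultralimit.
Context (R : realType) d (E : measurableType d) (T : ptopologicalType).
Hypothesis polishT : polish R T.
Variables (mu : probability E R) (nu : probability (borel T) R).
Variables (J : Type) (U : set_system J).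
Variable pi_ : J -> probability (E * borel T)%type R.
Hypothesis pi_mu : forall i A, measurable A -> pi_ i (A `*` setT) = mu A.
Hypothesis pi_nu : forall i B, measurable B -> pi_ i (setT `*` B) = nu B.

(** In contrast with a subsequence, an ultrafilter makes all the sequences
    [pi_ i S] converge at once, so finite additivity and the marginals pass to
    the limit for free.  The marginals being tight, the limit extends to a
    measure. *)
Lemma ultralimit_coupling : UltraFilter U ->
  exists pi : probability (E * borel T)%type R,
    [/\ (forall A, measurable A -> pi (A `*` setT) = mu A),
        (forall B, measurable B -> pi (setT `*` B) = nu B) &
        (forall A B, measurable A -> measurable B ->
           fine (pi_ i (A `*` B)) @[i --> U] --> fine (pi (A `*` B)))].
Proof.
move=> UU.
have /choice[L LP] : forall S : set (E * borel T), exists l : R,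
    (0 <= l)%R /\ (measurable S -> fine (pi_ i S) @[i --> U] --> l).
  move=> S; have [mS|mS] := pselect (measurable S); last by exists 0%R.
  have := @segment_compact R 0 1; rewrite compact_ultra.
  move=> /(_ (fine (pi_ i S) @[i --> U]) (ultra_fmap _ _)) [].
    apply: nearW => i /=; rewrite in_itv/= fine_ge0//= -lee_fin fineK.
      exact: probability_le1.
    exact: fin_num_measure.
  by move=> l [/=]; rewrite in_itv/= => /andP[l0 _] Ul; exists l.
pose m (S : set (rectangles_type E (borel T))) := (L S)%:E.
have m_ge0 S : 0 <= m S by rewrite lee_fin; case: (LP S).
have Lcvg S l : measurable S -> fine (pi_ i S) @[i --> U] --> l -> L S = l.
  move=> mS Sl; have [_ /(_ mS) SL] := LP S.
  exact: (cvg_unique _ SL Sl).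
have mrect S : rectangle S -> measurable (S : set (E * borel T)).
  by move=> [A [B [mA mB ->]]]; exact: measurableX.
have m_add : measure_function.semi_additive m.
  move=> F n mF tF mU'.
  have mU : measurable (\big[setU/set0]_(k < n) F k : set (E * borel T)).
    by apply: mrect; exact: mU'.
  have mF' k : measurable (F k : set (E * borel T)).
    by apply: mrect; exact: mF.
  rewrite /m sumEFin; congr (_%:E); apply: Lcvg => //.
  have -> : (fun i => fine (pi_ i (\big[setU/set0]_(k < n) F k))) =
      (fun i => \sum_(k < n) fine (pi_ i (F k)))%R.
    apply/funext => i; rewrite (measure_bigsetU (pi_ i) mF' tF).
    by rewrite sum_fine// => k _; exact: fin_num_measure.
  apply: cvg_big => [|k _]; first exact: add_continuous.
  by have [_] := LP (F k); exact.
have m_mu A : measurable A -> m (A `*` setT) = mu A.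
  move=> mA; rewrite /m -[RHS]fineK ?fin_num_measure//; congr (_%:E).
  apply: Lcvg; first exact: measurableX.
  by under eq_fun do rewrite pi_mu//; exact: cvg_cst.
have m_nu B : measurable B -> m (setT `*` B) = nu B.
  move=> mB; rewrite /m -[RHS]fineK ?fin_num_measure//; congr (_%:E).
  apply: Lcvg; first exact: measurableX.
  by under eq_fun do rewrite pi_nu//; exact: cvg_cst.
have [pi piE] := polish_rectangle_extension polishT m_ge0 m_add m_mu m_nu.
exists pi; split.
- by move=> A mA; rewrite piE//; exact: m_mu.
- by move=> B mB; rewrite piE//; exact: m_nu.
- move=> A B mA mB; rewrite piE//=.
  by have [_] := LP (A `*` B); apply; exact: measurableX.
Qed.

End ultralimit.

Lemma pushes_to_prod (R : realType) d1 d2 (T1 : measurableType d1)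
    (T2 : measurableType d2) (P : probability T1 R) (Q : probability T2 R)
    (f : T1 -> T2) : measurable_fun setT f -> pushes_to f P Q ->
  pushes_to (fun q : T1 * T1 => (f q.1, f q.2)) (P \x P) (Q \x Q).
Proof.
move=> mf fPQ A mA.
have mff : measurable_fun setT (fun q : T1 * T1 => (f q.1, f q.2)).
  by apply: measurable_fun_pair; exact: measurableT_comp.
rewrite /pushforward.
transitivity (push (P \x P) mff A); first by [].
apply/esym; apply: product_measure_unique => //= B C mB mC.
transitivity (P (f @^-1` B) * P (f @^-1` C)); last first.
  by congr (_ * _); exact: fPQ.
by rewrite -product_measure1E// -[X in measurable X]setTI; exact: mf.
Qed.

Section product_limit.
Context (R : realType) d1 d2 (E : measurableType d1) (T : measurableType d2).
Variables (mu : probability E R) (nu : probability T R).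
Context (J : Type) (F : set_system J).
Variables (pi_ : J -> probability (E * T)%type R) (pi : probability (E * T)%type R).
Hypothesis pi_mu : forall i, pushes_to fst (pi_ i) mu.
Hypothesis pi_nu : forall i, pushes_to snd (pi_ i) nu.
Hypothesis pimu : pushes_to fst pi mu.
Hypothesis pinu : pushes_to snd pi nu.

Let gE (q : (E * T) * (E * T)) := (q.1.1, q.2.1).
Let gT (q : (E * T) * (E * T)) := (q.1.2, q.2.2).

Let mgE : measurable_fun setT gE.
Proof. by apply: measurable_fun_pair; exact: measurableT_comp. Qed.

Let mgT : measurable_fun setT gT.
Proof. by apply: measurable_fun_pair; exact: measurableT_comp. Qed.

Let rects d (S : measurableType d) : set (set (S * S)) :=
  [set A `*` B | A in measurable & B in measurable].

Let rectsI d (S : measurableType d) : setI_closed (@rects _ S).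
Proof.
move=> _ _ [A mA [A' mA' <-]] [B mB [B' mB' <-]].
exists (A `&` B); first exact: measurableI.
exists (A' `&` B'); first exact: measurableI.
by rewrite setXI.
Qed.

(** For [P] and [Q] rectangles the sets are products of rectangles, and the limit
    is a product of limits.  [dynkin_limit] is then applied to [P] with the
    marginal on [E], and to [Q] with the marginal on [T]. *)
Lemma product_limit : ProperFilter F ->
  (forall A B, measurable A -> measurable B ->
    fine (pi_ i (A `*` B)) @[i --> F] --> fine (pi (A `*` B))) ->
  forall P Q, measurable P -> measurable Q ->
    fine ((pi_ i \x pi_ i) (gE @^-1` P `&` gT @^-1` Q)) @[i --> F] -->
    fine ((pi \x pi) (gE @^-1` P `&` gT @^-1` Q)).
Proof.
move=> FF conv.
have gE_ i A : measurable A -> (pi_ i \x pi_ i) (gE @^-1` A) = (mu \x mu) A.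
  by move=> mA; apply: (pushes_to_prod _ (pi_mu i)).
have gEpi A : measurable A -> (pi \x pi) (gE @^-1` A) = (mu \x mu) A.
  by move=> mA; apply: (pushes_to_prod _ pimu).
have gT_ i A : measurable A -> (pi_ i \x pi_ i) (gT @^-1` A) = (nu \x nu) A.
  by move=> mA; apply: (pushes_to_prod _ (pi_nu i)).
have gTpi A : measurable A -> (pi \x pi) (gT @^-1` A) = (nu \x nu) A.
  by move=> mA; apply: (pushes_to_prod _ pinu).
have mgE' A : measurable A -> measurable (gE @^-1` A).
  by move=> mA; rewrite -[X in measurable X]setTI; exact: mgE.
have mgT' A : measurable A -> measurable (gT @^-1` A).
  by move=> mA; rewrite -[X in measurable X]setTI; exact: mgT.
have rect A A' B B' : measurable A -> measurable A' -> measurable B ->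
    measurable B' ->
    fine ((pi_ i \x pi_ i) (gE @^-1` (A `*` A') `&` gT @^-1` (B `*` B')))
      @[i --> F] -->
    fine ((pi \x pi) (gE @^-1` (A `*` A') `&` gT @^-1` (B `*` B'))).
  move=> mA mA' mB mB'.
  have -> : gE @^-1` (A `*` A') `&` gT @^-1` (B `*` B') =
      (A `*` B) `*` (A' `*` B').
    by apply/seteqP; split => -[[a b] [a' b']] [[/= ? ?] [? ?]].
  have prodE (P : probability (E * T)%type R) :
      fine ((P \x P) ((A `*` B) `*` (A' `*` B'))) =
      (fine (P (A `*` B)) * fine (P (A' `*` B')))%R.
    rewrite product_measure1E; [|exact: measurableX|exact: measurableX].
    by rewrite fineM//; apply: fin_num_measure; exact: measurableX.
  by rewrite prodE; under eq_fun do rewrite prodE; apply: cvgM; exact: conv.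
have half P B B' : measurable P -> measurable B -> measurable B' ->
    fine ((pi_ i \x pi_ i) (gE @^-1` P `&` gT @^-1` (B `*` B'))) @[i --> F] -->
    fine ((pi \x pi) (gE @^-1` P `&` gT @^-1` (B `*` B'))).
  move=> mP mB mB'.
  have mBB : measurable (B `*` B') by exact: measurableX.
  apply: (@dynkin_limit _ _ _ _ _ _ _ (fun i => pi_ i \x pi_ i) (pi \x pi)
    (mu \x mu) gE (gT @^-1` (B `*` B')) mgE (mgT' _ mBB) gE_ gEpi (@rects _ E) FF) => //.
  - exact: measurable_prod_measurableType.
  - exact: rectsI.
  - have := @rect setT setT B B'.
    rewrite setXTT preimage_setT setTI.
    by apply.
  - by move=> _ [A mA [A' mA' <-]]; exact: rect.
move=> P Q mP mQ.
rewrite setIC.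
apply: (@dynkin_limit _ _ _ _ _ _ _ (fun i => pi_ i \x pi_ i) (pi \x pi)
    (nu \x nu) gT (gE @^-1` P) mgT (mgE' _ mP) gT_ gTpi (@rects _ T) FF) => //.
- exact: measurable_prod_measurableType.
- exact: rectsI.
- have := @half P setT setT mP measurableT measurableT.
  by rewrite setXTT preimage_setT setIT.
- move=> _ [B mB [B' mB' <-]]; rewrite setIC.
  exact: half.
Qed.

End product_limit.

(** * Lp norms: monotonicity, change of variables, lower bound *)

Section Lnorm_lemmas.
Context (R : realType).

Lemma le_Lnorm d (T : measurableType d) (mu : {measure set T -> \bar R})
    (p : \bar R) (f g : T -> R) : 1 <= p ->
  measurable_fun setT f -> measurable_fun setT g ->
  (\forall x \ae mu, (`|f x| <= `|g x|)%R) ->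
  'N[mu]_p[(fun x => (f x)%:E)] <= 'N[mu]_p[(fun x => (g x)%:E)].
Proof.
move=> p1 mf mg fg; rewrite unlock; case: p p1 => [r| |//]; last first.
  move=> _; case: ifPn => // _; apply: le_ess_sup.
  by apply: filterS fg => x; rewrite /= lee_fin.
rewrite lee_fin => r1; have r0 : (0 < r)%R by exact: lt_le_trans r1.
have mpow (h : T -> R) : measurable_fun setT h ->
    measurable_fun setT (fun x => (`|(h x)%:E| `^ r)).
  move=> mh; apply: (@measurableT_comp _ _ _ _ _ _ (fun x => x `^ r)).
    exact: measurable_poweR.
  by apply: measurableT_comp => //; exact/measurable_EFinP.
apply: gt0_ler_poweR.
- by rewrite invr_ge0 ltW.
- by rewrite in_itv/= leey andbT; apply: integral_ge0 => x _; rewrite lee_fin powR_ge0.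
- by rewrite in_itv/= leey andbT; apply: integral_ge0 => x _; rewrite lee_fin powR_ge0.
apply: ae_ge0_le_integral => //.
- by move=> x _; exact: poweR_ge0.
- exact: mpow.
- by move=> x _; exact: poweR_ge0.
- exact: mpow.
apply: filterS fg => x fgx _; apply: gt0_ler_poweR; first exact: ltW.
- by rewrite in_itv/= leey andbT.
- by rewrite in_itv/= leey andbT.
- by rewrite !abse_EFin lee_fin.
Qed.

Lemma Lnorm_pushes_to d1 d2 (T1 : measurableType d1) (T2 : measurableType d2)
    (mu : {measure set T1 -> \bar R}) (nu : {measure set T2 -> \bar R})
    (phi : T1 -> T2) (p : \bar R) (f : T2 -> R) : 1 <= p ->
  measurable_fun setT phi -> pushes_to phi mu nu -> measurable_fun setT f ->
  'N[nu]_p[(fun x => (f x)%:E)] = 'N[mu]_p[(fun x => (f (phi x))%:E)].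
Proof.
move=> p1 mphi munu mf; rewrite unlock; case: p p1 => [r| |//].
  rewrite lee_fin => r1; congr (_ `^ _).
  have mpow : measurable_fun setT (fun x => (`|(f x)%:E| `^ r)).
    apply: (@measurableT_comp _ _ _ _ _ _ (fun x => x `^ r)).
      exact: measurable_poweR.
    by apply: measurableT_comp => //; exact/measurable_EFinP.
  transitivity (\int[pushforward mu phi]_x (`|(f x)%:E| `^ r)).
    by apply: eq_measure_integral => A mA _; exact/esym/munu.
  rewrite ge0_integral_pushforward//.
  by move=> x _; exact: poweR_ge0.
move=> _; rewrite -(munu _ measurableT) /pushforward preimage_setT.
case: ifPn => // _.
have mabs : measurable_fun setT (abse \o (fun x => (f x)%:E)).
  by apply: measurableT_comp => //; exact/measurable_EFinP.
rewrite !ess_supEmu0//; last first.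
  apply: measurableT_comp => //; apply/measurable_EFinP.
  exact: measurableT_comp.
congr (ereal_inf _); apply/seteqP; split => y /= H.
  rewrite -[LHS]munu in H => //.
  by rewrite -[X in measurable X]setTI; apply: mabs => //; exact: emeasurable_itv.
rewrite -munu//.
by rewrite -[X in measurable X]setTI; apply: mabs => //; exact: emeasurable_itv.
Qed.

Lemma Lnorm_cst_lty d (T : measurableType d) (mu : probability T R)
    (p : \bar R) (c : R) : 1 <= p -> 'N[mu]_p[(fun=> c%:E)] < +oo.
Proof.
case: p => [r _| _|//].
  have := Lfun_cst mu c r; rewrite inE => /andP[_]; rewrite inE/=; exact.
rewrite unlock; case: ifPn => [mu0|_]; last exact: ltry.
rewrite (_ : abse \o _ = cst `|c%:E|)//.
by rewrite ess_sup_cst// ltry.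
Qed.

(** A form of Markov's inequality that is uniform in the exponent.  The bound
    compares with the norm of [e] times the indicator of [S]; on a probability
    space, [mu S] is at most its power of exponent [1/r]. *)
Lemma Lnorm_ge_measure d (T : measurableType d) (mu : probability T R)
    (p : \bar R) (f : T -> R) (e : R) (S : set T) : 1 <= p ->
  measurable_fun setT f -> measurable S -> (0 < e)%R ->
  (forall x, S x -> (e <= f x)%R) ->
  e%:E * mu S <= 'N[mu]_p[(fun x => (f x)%:E)].
Proof.
move=> p1 mf mS e0 ef.
have mg : measurable_fun setT (fun x => e * \1_S x)%R.
  by apply: measurable_funM => //; exact: measurable_indic.
apply: (@le_trans _ _ 'N[mu]_p[(fun x => (e * \1_S x)%:E)]); last first.
  apply: le_Lnorm => //; apply: aeW => x; rewrite indicE.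
  case: (boolP (x \in S)) => [/set_mem /ef efx|_] /=.
    by rewrite mulr1 (gtr0_norm e0) ger0_norm//; exact: le_trans (ltW e0) efx.
  by rewrite mulr0 normr0.
rewrite unlock; case: p p1 => [r| |//]; last first.
  move=> _; case: ifPn => [mu0|]; last first.
    by rewrite [X in 0 < X](_ : _ = 1) ?lte01//; exact: (probability_setT mu).
  have [muS|muS] := eqVneq (mu S) 0.
    by rewrite muS mule0; apply: ess_sup_gee => //; apply: aeW => x /=.
  have : e%:E * mu S <= e%:E.
    rewrite -[leRHS]mule1 lee_pmul2l ?lte_fin//; exact: probability_le1.
  move=> /le_trans; apply; rewrite leNgt; apply/negP => lte.
  have := ess_sup_ge mu (abse \o (fun x => (e * \1_S x)%:E)).
  move=> [N [mN N0 NS]].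
  have : mu S <= mu N.
    apply: le_measure; rewrite ?inE// => x Sx; apply: NS => /=.
    rewrite indicE mem_set// mulr1 => /le_lt_trans/(_ lte).
    by rewrite gtr0_norm// ltxx.
  by rewrite N0 measure_le0 (negbTE muS).
rewrite lee_fin => r1; have r0 : (0 < r)%R by exact: lt_le_trans r1.
(* Both e and the indicator go through the power r. *)
rewrite (_ : \int[mu]_x _ = (e `^ r)%:E * mu S); last first.
  under eq_integral.
    move=> x _; rewrite abse_EFin poweR_EFin.
    rewrite (_ : (`|e * \1_S x| `^ r)%R = (e `^ r * \1_S x)%R); last first.
      rewrite indicE; case: (x \in S) => /=; first by rewrite !mulr1 gtr0_norm.
      by rewrite !mulr0 normr0 powR0// gt_eqF.
    rewrite EFinM; over.
  rewrite ge0_integralZl_EFin ?powR_ge0//; last first.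
    by apply/measurable_EFinP; exact: measurable_indic.
  by rewrite integral_indic// setIT.
rewrite poweRM//; last by rewrite lee_fin powR_ge0.
rewrite poweR_EFin -powRrM mulfV ?gt_eqF// (powRr1 (ltW e0)).
rewrite lee_pmul2l ?lte_fin//.
have : mu S <= 1 by exact: probability_le1.
have : 0 <= mu S by [].
have : mu S \is a fin_num by exact: fin_num_measure.
case: (mu S) => [s _|//|//]; rewrite poweR_EFin !lee_fin => s0 s1.
move: s0; rewrite le_eqVlt => /predU1P[<-|s0].
  by rewrite powR_ge0.
by apply: ger1_powR; [rewrite s0|rewrite invf_le1].
Qed.

End Lnorm_lemmas.

(** * Products of Polish spaces and measurability of distances *)

HB.instance Definition _ (T1 T2 : ptopologicalType) := Pointed.on (T1 * T2)%type.

Lemma countable_bigcup_measurable d (T : measurableType d) (I : countType)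
    (P : set I) (F : I -> set T) :
  (forall i, measurable (F i)) -> measurable (\bigcup_(i in P) F i).
Proof.
move=> mF; rewrite bigcup_mkcond; apply: countable_bigcupT_measurable => // i.
by case: ifP.
Qed.

Lemma measurable_fun_borel d (T : measurableType d) (S : ptopologicalType)
    (f : T -> borel S) :
  (forall O : set S, open O -> measurable (f @^-1` O)) -> measurable_fun setT f.
Proof.
move=> fO; have H : @measurable _ (borel S) = <<s @open S >> by [].
apply: (measurability _ H).
by move=> _ [B oB <-]; rewrite setTI; exact: fO.
Qed.

Lemma polish_prod (R : realType) (T1 T2 : topologicalType) :
  polish R T1 -> polish R T2 -> polish R (T1 * T2)%type.
Proof.
move=> [[D1 cD1 dD1] [d1 [H1 H2 H3 H4 H5]]] [[D2 cD2 dD2] [d2 [K1 K2 K3 K4 K5]]].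
split.
  exists (D1 `*` D2); first exact: countableX.
  move=> O [[x y] Oxy] oO.
  have [[A B] [/= Ax By] ABO] : nbhs (x, y) O by exact: open_nbhs_nbhs.
  have [x' [Ax' Dx']] : interior A `&` D1 !=set0.
    by apply: dD1; [exists x|exact: open_interior].
  have [y' [By' Dy']] : interior B `&` D2 !=set0.
    by apply: dD2; [exists y|exact: open_interior].
  by exists (x', y'); split => //; apply: ABO; split => /=; exact: interior_subset.
exists (fun p q => Num.max (d1 p.1 q.1) (d2 p.2 q.2)); split.
- have d1_ge0 x y : (0 <= d1 x y)%R by exact: (@metrizes_ge0 _ _ d1).
  have d2_ge0 x y : (0 <= d2 x y)%R by exact: (@metrizes_ge0 _ _ d2).
  move=> [x y] [x' y'] /=; split.
    move=> m0; congr (_, _); [apply/H1|apply/K1]; apply/eqP.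
      by rewrite eq_le d1_ge0 -m0 le_max lexx.
    by rewrite eq_le d2_ge0 -m0 le_max lexx orbT.
  by move=> [-> ->]; rewrite ((H1 _ _).2 erefl) ((K1 _ _).2 erefl) maxxx.
- by move=> p q; rewrite H2 K2.
- move=> p q r; rewrite ge_max; apply/andP; split.
    by rewrite (le_trans (H3 _ q.1 _))// lerD// le_max lexx.
  by rewrite (le_trans (K3 _ q.2 _))// lerD// le_max lexx orbT.
- move=> [x y] A; split.
    move=> [[B C] [/= /H4[e e0 eB] /K4[r r0 rC]] BCA].
    exists (Num.min e r); first by rewrite lt_min e0 r0.
    move=> [x' y'] /=; rewrite gt_max !lt_min => /andP[/andP[xe _] /andP[_ yr]].
    by apply: BCA; split => /=; [exact: eB|exact: rC].
  move=> [e e0 eA].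
  exists ([set x' | (d1 x x' < e)%R], [set y' | (d2 y y' < e)%R]) => /=.
    by split; [apply/H4|apply/K4]; exists e.
  by move=> [x' y'] [/= xx yy]; apply: eA; rewrite /= gt_max xx yy.
- move=> u cu.
  have [l1 ul1] : exists l : T1, (fun n => (u n).1) @ \oo --> l.
    apply: H5 => e /cu[N NP]; exists N => m n mN nN.
    by have := NP m n mN nN; rewrite gt_max => /andP[].
  have [l2 ul2] : exists l : T2, (fun n => (u n).2) @ \oo --> l.
    apply: K5 => e /cu[N NP]; exists N => m n mN nN.
    by have := NP m n mN nN; rewrite gt_max => /andP[].
  exists (l1, l2).
  have -> : u = (fun n => ((u n).1, (u n).2)).
    by apply/funext => n; rewrite -surjective_pairing.
  exact: cvg_pair ul1 ul2.
Qed.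

(** Second countability makes the Borel sigma-algebra of the product no larger
    than the product of the Borel sigma-algebras. *)
Lemma borel_open_prod (R : realType) (X Y : ptopologicalType)
    (O : set (X * Y)) : polish R X -> polish R Y -> open O ->
  measurable (O : set (borel X * borel Y)).
Proof.
move=> [sX [dX [H1 H2 H3 H4 _]]] [sY [dY [K1 K2 K3 K4 _]]] oO.
have [U [oU bU]] := @metrizes_countable_base _ _ dX (And4 H1 H2 H3 H4) sX.
have [V [oV bV]] := @metrizes_countable_base _ _ dY (And4 K1 K2 K3 K4) sY.
rewrite (open_prod_rectangles (conj oU bU) (conj oV bV) oO).
apply: countable_bigcup_measurable.
by move=> [n m]; apply: measurableX; exact: borel_open.
Qed.

Section separable_target.
Context (R : realType) (Z : metricType R).
Hypothesis sepZ : separable_space Z.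

(** For open rectangles this is clear; separability of [Z] reduces an open set
    to countably many of them. *)
Lemma measurable_preimage_open_prod d (T : measurableType d) (f g : T -> Z)
    (O : set (Z * Z)) : borel_measurable f -> borel_measurable g -> open O ->
  measurable [set x | O (f x, g x)].
Proof.
move=> mf mg oO.
have [U [oU bU]] := metrizes_countable_base (metric_metrizes Z) sepZ.
rewrite (open_prod_rectangles (conj oU bU) (conj oU bU) oO).
rewrite (_ : [set x | _] = \bigcup_(p in
    [set p : nat * nat | U p.1 `*` U p.2 `<=` O]) (f @^-1` U p.1 `&` g @^-1` U p.2)).
  apply: countable_bigcup_measurable.
  move=> [n m]; apply: measurableI.
    by apply: mf; exact: sub_sigma_algebra.
  by apply: mg; exact: sub_sigma_algebra.
by apply/seteqP; split => x [p pO px]; exists p.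
Qed.

Lemma open_mdist_gt (r : R) : open [set p : Z * Z | (r < mdist p.1 p.2)%R].
Proof.
rewrite openE => -[x y] /= xy.
pose e := ((mdist x y - r) / 2)%R.
have e0 : (0 < e)%R by rewrite divr_gt0// subr_gt0.
exists ([set x' | (mdist x x' < e)%R], [set y' | (mdist y y' < e)%R]).
  have [_ _ _ H4] := metric_metrizes Z.
  by split; apply/H4; exists e.
move=> [x' y'] [/= xx yy].
have H := metric_triangle x x' y; have H' := metric_triangle x' y' y.
rewrite (metric_sym y' y) in H'.
by rewrite /e in xx yy; lra.
Qed.

Lemma measurable_mdist d (T : measurableType d) (f g : T -> Z) :
  borel_measurable f -> borel_measurable g ->
  measurable_fun setT (fun x => mdist (f x) (g x)).
Proof.
move=> mf mg; apply: (measurability _ (RGenOInfty.measurableE R)).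
move=> _ [_ [r ->] <-]; rewrite setTI.
rewrite (_ : _ @^-1` _ = [set x | (r < mdist (f x) (g x))%R]).
  exact: (measurable_preimage_open_prod mf mg (@open_mdist_gt r)).
by apply/seteqP; split => x /=; rewrite in_itv/= andbT.
Qed.

End separable_target.

Lemma borel_measurable_comp d1 d2 (T1 : measurableType d1)
    (T2 : measurableType d2) (Z : topologicalType) (f : T2 -> Z) (phi : T1 -> T2) :
  borel_measurable f -> measurable_fun setT phi ->
  borel_measurable (fun x => f (phi x)).
Proof.
move=> mf mphi B mB; rewrite -[X in measurable X]setTI.
exact: (mphi measurableT _ (mf _ mB)).
Qed.

Lemma borel_measurable_cst d (T : measurableType d) (Z : topologicalType) (z : Z) :
  borel_measurable (fun _ : T => z).
Proof. by move=> B mB; rewrite preimage_cst; case: ifP. Qed.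

(** * Gromov-Wasserstein is a pseudometric *)

Section GW_metric.
Context (R : realType) (Z : metricType R) (p : \bar R).
Hypothesis sepZ : separable_space Z.
Hypothesis p1 : 1 <= p.
Implicit Types X Y V : network Z p.

Lemma measurable_omega_comp d (G : measurableType d) X
    (a b : G -> borel (net_space X)) :
  measurable_fun setT a -> measurable_fun setT b ->
  borel_measurable (fun q => net_omega X (a q, b q)).
Proof.
move=> ma mb; apply: (borel_measurable_comp (@net_omega_measurable _ _ _ X)).
exact: measurable_fun_pair.
Qed.

(** The distortion of a pair of maps out of an auxiliary space [G]: couplings,
    glued measures and common covers are all treated as special cases. *)
Definition mismatch d (G : measurableType d) X Y
    (a : G -> borel (net_space X)) (b : G -> borel (net_space Y)) (q : G * G) : R :=
  mdist (net_omega X (a q.1, a q.2)) (net_omega Y (b q.1, b q.2)).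

Lemma measurable_mismatch d (G : measurableType d) X Y
    (a : G -> borel (net_space X)) (b : G -> borel (net_space Y)) :
  measurable_fun setT a -> measurable_fun setT b ->
  measurable_fun setT (mismatch a b).
Proof.
move=> ma mb; apply: (measurable_mdist sepZ);
  by apply: measurable_omega_comp; exact: measurableT_comp.
Qed.

(** The distortion of a coupling can be computed on any probability space that
    parametrizes it. *)
Lemma distortion_pull d (G : measurableType d) (g : probability G R) X Y
    (a : G -> borel (net_space X)) (b : G -> borel (net_space Y))
    (pi : probability (borel (net_space X) * borel (net_space Y))%type R) :
  measurable_fun setT a -> measurable_fun setT b ->
  pushes_to (fun w => (a w, b w)) g pi ->
  distortion X Y pi = 'N[g \x g]_p[(fun q => (mismatch a b q)%:E)].
Proof.
move=> ma mb gpi.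
have mab : measurable_fun setT (fun w => (a w, b w)) by exact: measurable_fun_pair.
have mabab : measurable_fun setT
    (fun q : G * G => ((a q.1, b q.1), (a q.2, b q.2))).
  apply: measurable_fun_pair; first exact: (measurableT_comp mab measurable_fst).
  exact: (measurableT_comp mab measurable_snd).
exact: (Lnorm_pushes_to p1 mabab (pushes_to_prod mab gpi)
  (measurable_mismatch measurable_fst measurable_snd)).
Qed.

Lemma coupling_of_maps d (G : measurableType d) (g : probability G R) X Y
    (a : G -> borel (net_space X)) (b : G -> borel (net_space Y)) :
  measurable_fun setT a -> measurable_fun setT b ->
  pushes_to a g (net_mu X) -> pushes_to b g (net_mu Y) ->
  exists2 pi, couplings X Y pi &
    distortion X Y pi = 'N[g \x g]_p[(fun q => (mismatch a b q)%:E)].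
Proof.
move=> ma mb gX gY.
have mab : measurable_fun setT (fun w => (a w, b w)) by exact: measurable_fun_pair.
exists (push g mab); last by apply: distortion_pull.
by split => A mA; [exact: gX|exact: gY].
Qed.

Lemma distortion_ge0 X Y pi : 0 <= distortion X Y pi.
Proof. exact: Lnorm_ge0. Qed.

Lemma inf_distortion_ge0 X Y :
  0 <= ereal_inf [set distortion X Y pi | pi in couplings X Y].
Proof. by apply: le_ereal_inf_tmp => _ [pi _ <-]; exact: distortion_ge0. Qed.

Lemma GW_ge0 X Y : 0 <= GW X Y.
Proof. by rewrite mule_ge0 ?lee_fin ?invr_ge0// inf_distortion_ge0. Qed.

Lemma GW_sym X Y : GW X Y = GW Y X.
Proof.
suff le X' Y' : GW X' Y' <= GW Y' X' by apply/eqP; rewrite eq_le !le.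
rewrite lee_pmul2l ?lte_fin ?invr_gt0//.
apply: le_ereal_inf_tmp => _ [pi [piY piX] <-].
have [pi' cpi' dpi'] := @coupling_of_maps _ _ pi X' Y' snd fst
  measurable_snd measurable_fst piX piY.
apply: ereal_inf_lbound; exists pi' => //; rewrite dpi'.
congr Lnorm; apply/funext => q; congr (_%:E); exact: metric_sym.
Qed.

(** The base point of the integrability condition can be changed at the cost of
    a constant. *)
Lemma network_moment X (z : Z) :
  'N[net_mu X \x net_mu X]_p[(fun q => (mdist (net_omega X q) z)%:E)] < +oo.
Proof.
have [z0 Hz0] := net_omega_Lp X.
have mX (z' : Z) : measurable_fun setT (fun q => mdist (net_omega X q) z').
  apply: (measurable_mdist sepZ); first exact: net_omega_measurable.
  exact: borel_measurable_cst.
have mc : measurable_fun [set: borel (net_space X) * borel (net_space X)]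
  (fun=> mdist z0 z) by exact: measurable_cst.
apply: (@le_lt_trans _ _ ('N[net_mu X \x net_mu X]_p
    [(fun q => (mdist (net_omega X q) z0 + mdist z0 z)%:E)])).
  apply: le_Lnorm => //; first exact: measurable_funD.
  apply: aeW => q; rewrite !ger0_norm ?addr_ge0 ?mdist_ge0//.
  exact: metric_triangle.
apply: (le_lt_trans (eminkowski _ (mX z0) mc p1)).
apply: lte_add_pinfty => //; exact: Lnorm_cst_lty.
Qed.

(** The product coupling has finite distortion. *)
Lemma inf_distortion_lty X Y :
  ereal_inf [set distortion X Y pi | pi in couplings X Y] < +oo.
Proof.
have [z0 _] := net_omega_Lp X.
pose g : probability (borel (net_space X) * borel (net_space Y))%type R :=
  (net_mu X \x net_mu Y)%E.
have gX : pushes_to fst g (net_mu X).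
  move=> A mA; rewrite /pushforward.
  rewrite (_ : fst @^-1` A = A `*` setT); last first.
    by apply/seteqP; split => -[x y] //= [].
  transitivity ((net_mu X \x net_mu Y)%E (A `*` setT)); first by [].
  rewrite product_measure1E// -[RHS]mule1; congr (_ * _).
  exact: probability_setT.
have gY : pushes_to snd g (net_mu Y).
  move=> A mA; rewrite /pushforward.
  rewrite (_ : snd @^-1` A = setT `*` A); last first.
    by apply/seteqP; split => -[x y] //= [].
  transitivity ((net_mu X \x net_mu Y)%E (setT `*` A)); first by [].
  rewrite product_measure1E// -[RHS]mul1e; congr (_ * _).
  exact: probability_setT.
have [pi cpi dpi] := @coupling_of_maps _ _ g X Y fst snd
  measurable_fst measurable_snd gX gY.
apply: (@le_lt_trans _ _ (distortion X Y pi)).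
  by apply: ereal_inf_lbound; exists pi.
rewrite dpi.
pose fX (q : borel (net_space X) * borel (net_space X)) := mdist (net_omega X q) z0.
pose fY (q : borel (net_space Y) * borel (net_space Y)) := mdist (net_omega Y q) z0.
have mfX : measurable_fun setT fX.
  apply: (measurable_mdist sepZ); first exact: net_omega_measurable.
  exact: borel_measurable_cst.
have mfY : measurable_fun setT fY.
  apply: (measurable_mdist sepZ); first exact: net_omega_measurable.
  exact: borel_measurable_cst.
have m1 : measurable_fun setT (fun q : (borel (net_space X) * borel (net_space Y)) *
    (borel (net_space X) * borel (net_space Y)) => (q.1.1, q.2.1)).
  by apply: measurable_fun_pair; exact: measurableT_comp.
have m2 : measurable_fun setT (fun q : (borel (net_space X) * borel (net_space Y)) *
    (borel (net_space X) * borel (net_space Y)) => (q.1.2, q.2.2)).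
  by apply: measurable_fun_pair; exact: measurableT_comp.
have mX' := measurableT_comp mfX m1.
have mY' := measurableT_comp mfY m2.
apply: (@le_lt_trans _ _ ('N[g \x g]_p
    [(fun q => (fX (q.1.1, q.2.1) + fY (q.1.2, q.2.2))%:E)])).
  apply: le_Lnorm => //.
  - by apply: measurable_mismatch.
  - exact: measurable_funD.
  apply: aeW => q; rewrite !ger0_norm ?addr_ge0 ?mdist_ge0//.
  by rewrite /fY (metric_sym _ z0); exact: metric_triangle.
apply: (le_lt_trans (eminkowski _ mX' mY' p1)).
apply: lte_add_pinfty.
  have := Lnorm_pushes_to p1 m1 (pushes_to_prod measurable_fst gX) mfX.
  by rewrite /comp => <-; exact: network_moment.
have := Lnorm_pushes_to p1 m2 (pushes_to_prod measurable_snd gY) mfY.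
by rewrite /comp => <-; exact: network_moment.
Qed.

Lemma inf_distortion_fin_num X Y :
  ereal_inf [set distortion X Y pi | pi in couplings X Y] \is a fin_num.
Proof. by rewrite ge0_fin_numE ?inf_distortion_lty// inf_distortion_ge0. Qed.

Lemma GW_fin_num X Y : GW X Y \is a fin_num.
Proof. by rewrite fin_numM// inf_distortion_fin_num. Qed.

(** All three distortions are computed on the gluing of two almost optimal
    couplings. *)
Lemma GW_triangle X Y V : GW X V <= GW X Y + GW Y V.
Proof.
rewrite -muleDr//; last by rewrite fin_num_adde_defl// inf_distortion_fin_num.
rewrite lee_pmul2l ?lte_fin ?invr_gt0//.
set iXY := ereal_inf [set distortion X Y pi | pi in _].
set iYV := ereal_inf [set distortion Y V pi | pi in _].
apply/lee_addgt0Pr => e e0.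
have e20 : (0 < e / 2)%R by rewrite divr_gt0.
have [_ [pi [piX piY] <-] pie] := lb_ereal_inf_adherent e20 (inf_distortion_fin_num X Y).
have [_ [rho [rhoY rhoV] <-] rhoe] := lb_ereal_inf_adherent e20 (inf_distortion_fin_num Y V).
have rho_mu B : measurable B -> rho (B `*` setT) = push pi measurable_snd B.
  move=> mB; rewrite pushE; transitivity (net_mu Y B); last by rewrite -(piY _ mB).
  rewrite -(rhoY _ mB) /pushforward; congr (rho _).
  by apply/seteqP; split => -[y z] //= [].
have [g [gpi grho]] := gluing (net_polish V) rho_mu.
have gXY : pushes_to fst g pi.
  move=> A mA; rewrite -gpi// /pushforward; congr (g _).
  by apply/seteqP; split => -[y z] //= [].
pose toX (w : (borel (net_space X) * borel (net_space Y)) * borel (net_space V)) := w.1.1.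
pose toY (w : (borel (net_space X) * borel (net_space Y)) * borel (net_space V)) := w.1.2.
pose toV (w : (borel (net_space X) * borel (net_space Y)) * borel (net_space V)) := w.2.
have mtoX : measurable_fun setT toX by exact: measurableT_comp.
have mtoY : measurable_fun setT toY by exact: measurableT_comp.
have mtoV : measurable_fun setT toV by exact: measurable_snd.
have gXY' : pushes_to (fun w => (toX w, toY w)) g pi.
  by move=> A mA; rewrite -gXY// /pushforward; congr (g _);
     apply/seteqP; split => -[[x y] z].
have gYV : pushes_to (fun w => (toY w, toV w)) g rho.
  have mYV : measurable_fun setT (fun w => (toY w, toV w)) by exact: measurable_fun_pair.
  move=> A mA; apply: (@prob_rect_unique _ _ _ _ _ (push g mYV) rho) => //.
have gX : pushes_to toX g (net_mu X).
  move=> A mA; rewrite -(piX _ mA); apply: gXY.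
  by rewrite -[X in measurable X]setTI; exact: measurable_fst.
have gV : pushes_to toV g (net_mu V).
  move=> A mA; rewrite -(rhoV _ mA); apply: (gYV (snd @^-1` A)).
  by rewrite -[X in measurable X]setTI; exact: measurable_snd.
have [tau ctau dtau] := coupling_of_maps mtoX mtoV gX gV.
apply: (@le_trans _ _ (distortion X V tau)).
  by apply: ereal_inf_lbound; exists tau.
apply: (@le_trans _ _ (distortion X Y pi + distortion Y V rho)); last first.
  rewrite (splitr e) EFinD addeACA; apply: leeD; exact: ltW.
rewrite dtau (distortion_pull mtoX mtoY gXY') (distortion_pull mtoY mtoV gYV).
apply: le_trans (eminkowski _ (measurable_mismatch mtoX mtoY)
  (measurable_mismatch mtoY mtoV) p1).
apply: le_Lnorm => //.
- exact: measurable_mismatch.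
- by apply: measurable_funD; exact: measurable_mismatch.
apply: aeW => q; rewrite !ger0_norm ?addr_ge0 ?mdist_ge0//.
exact: metric_triangle.
Qed.

Lemma weakly_isomorphic_GW0 X Y : weakly_isomorphic X Y -> GW X Y = 0.
Proof.
move=> [W [phiX [phiY [mX mY pX pY H]]]].
have [pi cpi dpi] := coupling_of_maps mX mY pX pY.
have d0 : distortion X Y pi = 0.
  apply/eqP; rewrite eq_le distortion_ge0 andbT dpi.
  have p0 : p != 0 by rewrite gt_eqF// (lt_le_trans _ p1).
  rewrite -(Lnorm0 (net_mu W \x net_mu W) p0).
  apply: le_Lnorm => //; first exact: measurable_mismatch.
  apply: filterS H => q [_ XY]; rewrite /mismatch XY mdistxx//.
apply/eqP; rewrite eq_le GW_ge0 andbT.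
rewrite -[leRHS](mule0 (2^-1)%:E) lee_pmul2l ?lte_fin ?invr_gt0//.
by rewrite -d0; apply: ereal_inf_lbound; exists pi.
Qed.

End GW_metric.

(** * Networks at distance zero *)

Lemma countable_bigcup_negligible (R : realType) d (T : measurableType d)
    (mu : {measure set T -> \bar R}) (I : countType) (P : set I) (F : I -> set T) :
  (forall i, P i -> mu.-negligible (F i)) -> mu.-negligible (\bigcup_(i in P) F i).
Proof.
move=> F0; pose G n := if unpickle n is Some i then
  (if i \in P then F i else set0) else set0.
apply: (@negligibleS _ _ _ _ (\bigcup_n G n)).
  by move=> x [i Pi Fix]; exists (pickle i) => //; rewrite /G pickleK mem_set.
apply: negligible_bigcup => n; rewrite /G; case: unpickle => [i|].
  by case: ifPn => [/set_mem/F0//|_]; exact: negligible_set0.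
exact: negligible_set0.
Qed.

Lemma product_measure_fin_num (R : realType) d (T : measurableType d)
    (P : probability T R) (S : set (T * T)) :
  measurable S -> (P \x P) S \is a fin_num.
Proof.
exact: (fin_num_measure ((P \x P)%E : probability (T * T)%type R)).
Qed.

Section GW_zero.
Context (R : realType) (Z : metricType R) (p : \bar R).
Hypothesis sepZ : separable_space Z.
Hypothesis p1 : 1 <= p.
Variables X Y : network Z p.

Local Notation TX := (net_space X).
Local Notation TY := (net_space Y).

Local Notation TXY := (TX * TY)%type.
Let toX : borel TXY -> borel TX := fst.
Let toY : borel TXY -> borel TY := snd.
Let toXY : borel TX * borel TY -> borel TXY := id.

Let mtoXY : measurable_fun setT toXY.
Proof.
apply: measurable_fun_borel => O oO.
exact: borel_open_prod (net_polish X) (net_polish Y) oO.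
Qed.

Let mtoX : measurable_fun setT toX.
Proof.
apply: measurable_fun_borel => O oO; apply: borel_open.
by apply: open_comp oO => q _; exact: cvg_fst.
Qed.

Let mtoY : measurable_fun setT toY.
Proof.
apply: measurable_fun_borel => O oO; apply: borel_open.
by apply: open_comp oO => q _; exact: cvg_snd.
Qed.

Section product_network.
Variable pi : probability (borel TX * borel TY)%type R.
Hypothesis piX : pushes_to fst pi (net_mu X).
Hypothesis piY : pushes_to snd pi (net_mu Y).

Let omega (q : borel TXY * borel TXY) := net_omega X (toX q.1, toX q.2).

Let omega_measurable : borel_measurable omega.
Proof.
by apply: measurable_omega_comp; apply: measurableT_comp.
Qed.

Let pushX : pushes_to toX (push pi mtoXY) (net_mu X).
Proof. by move=> A mA; rewrite -(piX mA). Qed.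

Let pushY : pushes_to toY (push pi mtoXY) (net_mu Y).
Proof. by move=> A mA; rewrite -(piY mA). Qed.

Let omega_Lp : exists z0 : Z,
  'N[push pi mtoXY \x push pi mtoXY]_p[(fun q => (mdist (omega q) z0)%:E)] < +oo.
Proof.
have [z0 _] := net_omega_Lp X; exists z0.
have mtoX2 : measurable_fun setT (fun q : borel TXY * borel TXY => (toX q.1, toX q.2)).
  apply: measurable_fun_pair.
    exact: (measurableT_comp mtoX measurable_fst).
  exact: (measurableT_comp mtoX measurable_snd).
have mX : measurable_fun setT (fun q => mdist (net_omega X q) z0).
  apply: (measurable_mdist sepZ); first exact: net_omega_measurable.
  exact: borel_measurable_cst.
have := Lnorm_pushes_to p1 mtoX2 (pushes_to_prod mtoX pushX) mX.
by move=> <-; exact: network_moment.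
Qed.

(** The common cover of [X] and [Y]: the product space, with the coupling [pi]
    transported to the Borel sigma-algebra of the product topology, and the
    network function of [X]. *)
Definition product_network : network Z p :=
  Network (polish_prod (net_polish X) (net_polish Y)) omega_measurable omega_Lp.

Lemma product_network_weakly_isomorphic :
  (pi \x pi) [set q | (0 < mismatch (X := X) (Y := Y) fst snd q)%R] = 0 ->
  weakly_isomorphic X Y.
Proof.
move=> pi0; exists product_network, toX, toY; split => //.
pose N := [set q | (0 < mismatch (X := X) (Y := Y) toX toY q)%R].
have mN : measurable N.
  have := @measurable_mismatch _ _ _ sepZ _ _ X Y toX toY mtoX mtoY.
  move=> /(_ measurableT `]0%R, +oo[%classic (measurable_itv _)).
  rewrite setTI; congr measurable; apply/seteqP; split => q /=;
    by rewrite in_itv/= andbT.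
exists N; split => //.
  have pushXY : pushes_to toXY pi (push pi mtoXY) by [].
  have <- := pushes_to_prod mtoXY pushXY mN.
  exact: pi0.
by move=> q /= Hq; rewrite /N/= /mismatch mdist_gt0; apply/eqP => XY; exact: Hq.
Qed.

End product_network.

(** The infimum is zero, and the limit along an ultrafilter of almost optimal
    couplings attains it. *)
Lemma GW0_weakly_isomorphic : GW X Y = 0 -> weakly_isomorphic X Y.
Proof.
move=> GW0.
have inf0 : ereal_inf [set distortion X Y pi | pi in couplings X Y] = 0.
  apply/eqP; move/eqP: GW0; rewrite /GW mule_eq0 => /orP[|//].
  by rewrite eqe gt_eqF.
have /choice[pi_ pi_P] : forall n : nat, exists pi, couplings X Y pi /\
    distortion X Y pi < (n.+1%:R^-1)%:E.
  move=> n; have n0 : (0 < n.+1%:R^-1 :> R)%R by rewrite invr_gt0.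
  have [_ [pi cpi <-] dpi] := lb_ereal_inf_adherent n0 (inf_distortion_fin_num sepZ p1 X Y).
  by exists pi; rewrite inf0 add0e in dpi.
have [U [UU ooU]] := ultraFilterLemma (@eventually_filter).
have piX_ n A : measurable A -> pi_ n (A `*` setT) = net_mu X A.
  move=> mA; have [[H _] _] := pi_P n; rewrite -(H _ mA) /pushforward.
  by congr (pi_ n _); apply/seteqP; split => -[x y] //= [].
have piY_ n B : measurable B -> pi_ n (setT `*` B) = net_mu Y B.
  move=> mB; have [[_ H] _] := pi_P n; rewrite -(H _ mB) /pushforward.
  by congr (pi_ n _); apply/seteqP; split => -[x y] //= [].
have [pi [piX' piY' picvg]] := ultralimit_coupling (net_polish Y) piX_ piY_ UU.
have piX : pushes_to fst pi (net_mu X).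
  move=> A mA; rewrite -piX'// /pushforward.
  by congr (pi _); apply/seteqP; split => -[x y] //= [].
have piY : pushes_to snd pi (net_mu Y).
  move=> A mA; rewrite -piY'// /pushforward.
  by congr (pi _); apply/seteqP; split => -[x y] //= [].
apply: (product_network_weakly_isomorphic piX piY).
have [V [oV bV]] := metrizes_countable_base (metric_metrizes Z) sepZ.
(* On a cell the two network functions stay at distance at least e, so its
   measure under pi_ i times e is at most the distortion of pi_ i. *)
have cell (e : R) n m : (0 < e)%R ->
    V n `*` V m `<=` [set z : Z * Z | (e < mdist z.1 z.2)%R] ->
  (pi \x pi).-negligible ((fun q => (q.1.1, q.2.1)) @^-1` (net_omega X @^-1` V n) `&`
    (fun q => (q.1.2, q.2.2)) @^-1` (net_omega Y @^-1` V m)).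
  move=> e0 Vnm.
  set S := _ `&` _.
  have mVX : measurable (net_omega X @^-1` V n).
    by apply: net_omega_measurable; exact: sub_sigma_algebra.
  have mVY : measurable (net_omega Y @^-1` V m).
    by apply: net_omega_measurable; exact: sub_sigma_algebra.
  have mS : measurable S.
    apply: measurableI.
      rewrite -[X in measurable X]setTI.
      have mm : measurable_fun setT
        (fun q : (borel TX * borel TY) * (borel TX * borel TY) => (q.1.1, q.2.1)).
        by apply: measurable_fun_pair; exact: measurableT_comp.
      exact: mm.
    rewrite -[X in measurable X]setTI.
    have mm : measurable_fun setT
        (fun q : (borel TX * borel TY) * (borel TX * borel TY) => (q.1.2, q.2.2)).
      by apply: measurable_fun_pair; exact: measurableT_comp.
    exact: mm.
  exists S; split => //.
  have cvgS := product_limit (fun i => (pi_P i).1.1) (fun i => (pi_P i).1.2)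
    piX piY (@ultra_proper _ _ UU) picvg mVX mVY.
  have small i : (e * fine ((pi_ i \x pi_ i) S) < i.+1%:R^-1)%R.
    rewrite -lte_fin EFinM fineK ?product_measure_fin_num//.
    apply: le_lt_trans (pi_P i).2.
    apply: Lnorm_ge_measure => //.
      exact: (measurable_mismatch sepZ measurable_fst measurable_snd).
    by move=> q [/= qX qY]; apply: ltW; apply: (Vnm (_, _)); split.
  set l := fine ((pi \x pi) S) in cvgS.
  have l0 : (0 <= l)%R by rewrite fine_ge0.
  have Sl : (pi \x pi) S = l%:E by rewrite fineK// product_measure_fin_num.
  apply: (etrans Sl); congr (_%:E); apply/eqP; rewrite eq_le l0 andbT leNgt.
  apply/negP => lpos.
  have l20 : (0 < l / 2)%R by rewrite divr_gt0.
  move/cvgrPdist_lt : cvgS => /(_ _ l20) near1.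
  have [k kP] := exists_natSinv_lt (mulr_gt0 e0 l20).
  have near2 : U [set i | (k <= i)%N] by apply: ooU; exists k.
  have [i [/= lt1 ki]] := filter_ex (filterI near1 near2).
  have := small i; have := kP i ki.
  move=> H1 H2; have := lt_trans H2 H1; rewrite ltr_pM2l// => H3.
  move: lt1; rewrite ltr_norml => /andP[_]; rewrite -/l; lra.
apply: measure_negligible.
  have := @measurable_mismatch _ _ _ sepZ _ _ X Y fst snd
    (@measurable_fst _ _ (borel TX) (borel TY)) measurable_snd.
  move=> /(_ measurableT `]0%R, +oo[%classic (measurable_itv _)).
  rewrite setTI; congr measurable; apply/seteqP; split => q /=;
    by rewrite in_itv/= andbT.
(* The cells cover the mismatch set: first bound the distance below by some
   1/(k+1), then use the countable base of Z on the open set of pairs at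
   distance more than 1/(k+1). *)
apply: (@negligibleS _ _ _ _ (\bigcup_k \bigcup_(nm in
  [set nm : nat * nat | V nm.1 `*` V nm.2 `<=`
     [set z : Z * Z | (k.+1%:R^-1 < mdist z.1 z.2)%R]])
  ((fun q => (q.1.1, q.2.1)) @^-1` (net_omega X @^-1` V nm.1) `&`
    (fun q => (q.1.2, q.2.2)) @^-1` (net_omega Y @^-1` V nm.2)))).
  move=> q /= /exists_natSinv_lt[k /(_ k (leqnn _)) kq]; exists k => //.
  have kO := @open_mdist_gt R Z k.+1%:R^-1.
  have Hq : [set z : Z * Z | (k.+1%:R^-1 < mdist z.1 z.2)%R]
    (net_omega X (q.1.1, q.2.1), net_omega Y (q.1.2, q.2.2)) by [].
  rewrite (open_prod_rectangles (conj oV bV) (conj oV bV) kO) in Hq.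
  by case: Hq => nm nmP [Vn Vm]; exists nm.
apply: negligible_bigcup => k; apply: countable_bigcup_negligible => -[n m] /= Vnm.
by apply: (cell (k.+1%:R^-1)%R) => //; rewrite invr_gt0.
Qed.

End GW_zero.

Theorem theorem29 (R : realType) (Z : metricType R)
    (hZ : separable_space Z) (p : \bar R) (hp : 1 <= p) :
  induces_metric (@weakly_isomorphic R Z p) (@GW R Z p).
Proof.
split.
- exact: GW_fin_num.
- exact: GW_ge0.
- exact: GW_sym.
- exact: GW_triangle.
- move=> X Y; split; first exact: GW0_weakly_isomorphic.
  exact: weakly_isomorphic_GW0.
Qed.
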